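(* Let $d\ge2$ and let $\mathbb{F}_d$ be the free group on $d$ generators. (1) For $2\leq p<\infty$, the $C^*$-algebra $C^*_{\ell_p}(\mathbb{F}_d)$ is canonically isomorphic to $C^*_{D_p^+}(\mathbb{F}_d)$. In particular, $C^*_\lambda(\mathbb{F}_d)=C^*_{D_2^+}(\mathbb{F}_d)$. (2) For $2<p\leq\infty$, the $C^*$-algebra $C^*_{\ell_p}(\mathbb{F}_d)$ is canonically isomorphic to $C^*_{D_p^-}(\mathbb{F}_d)$. In particular, $C^*(\mathbb{F}_d)=C^*_{D_\infty^-}(\mathbb{F}_d)$.
   Context: Let $\Gamma$ be a countable discrete group. For a unitary representation $\pi$ of $\Gamma$ on a Hilbert space $\mathcal{H}$ and $\xi,\eta\in\mathcal{H}$, put $\pi_{\xi,\eta}(s)=\langle\pi(s)\xi,\eta\rangle$. Let $D$ be a non-zero translation invariant (under left and right translations by $\Gamma$) algebraic two-sided ideal of $\ell_\infty(\Gamma)$. A unitary representation $\pi$ on $\mathcal{H}$ is a $D$-representation if there is a dense subspace $\mathcal{H}_0\subset\mathcal{H}$ with $\pi_{\xi,\eta}\in D$ for all $\xi,\eta\in\mathcal{H}_0$. $C_D^*(\Gamma)$ is the completion of the group ring $\mathbb{C}\Gamma$ in the norm $\|f\|_D=\sup\{\|\pi(f)\|:\pi\text{ is a }D\text{-representation}\}$, where $\pi(f)=\sum_{s}f(s)\pi(s)$; $C^*_{\ell_p}(\Gamma)$ is the case $D=\ell_p(\Gamma)$. $C^*(\Gamma)$ and $C^*_\lambda(\Gamma)$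 denote the full and reduced group $C^*$-algebras. The ideals $D_p^{\pm}$ are $$D_p^-(\Gamma)=\bigcup_{\varepsilon>0}\ell_{p-\varepsilon}(\Gamma)\quad(1<p\le\infty),\qquad D_p^+(\Gamma)=\bigcap_{\varepsilon>0}\ell_{p+\varepsilon}(\Gamma)\quad(1\le p<\infty),$$ where in the union only exponents in $[1,p)$ are used, i.e. $D_p^-(\Gamma)=\bigcup_{1\le q<p}\ell_q(\Gamma)$; in particular $D_\infty^-(\Gamma)=\bigcup_{1\le q<\infty}\ell_q(\Gamma)$. Two such completions of $\mathbb{C}\Gamma$ are canonically isomorphic (also written with ''$=$'') if the identity map of $\mathbb{C}\Gamma$ extends to a $*$-isomorphism between them, i.e. the corresponding norms on $\mathbb{C}\Gamma$ coincide. *)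

(* Defs.v *)
From HB Require Import structures.
From mathcomp Require Import all_boot all_order all_algebra finmap.
From mathcomp Require Import complex sesquilinear.
From mathcomp Require Import all_classical all_reals all_analysis.
(* The notations of [monalg] clash with those of the analysis library. *)
From mathcomp Require Import -(notations) monalg.

Set Implicit Arguments.
Unset Strict Implicit.
Unset Printing Implicit Defensive.

Import Order.TTheory GRing.Theory Num.Theory.
Import numFieldNormedType.Exports.

Local Open Scope classical_set_scope.
Local Open Scope ring_scope.

Section FreeGroup.
Variable d : nat.

(* [(i, false)] is the i-th generator and [(i, true)] its inverse. *)
Definition letter : Type := ('I_d * bool)%type.
HB.instance Definition _ := Finite.on letter.

Definition inv_letter (a : letter) : letter := (a.1, ~~ a.2).

Definition reduced (w : seq letter) : bool :=
  sorted (fun a b => b != inv_letter a) w.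

Definition push (a : letter) (w : seq letter) : seq letter :=
  if w is b :: w' then if b == inv_letter a then w' else a :: w else [:: a].

Record free_group : predArgType :=
  FreeGroup { fg_word : seq letter; fg_reduced : reduced fg_word }.
HB.instance Definition _ := [isSub for fg_word].
HB.instance Definition _ := [Choice of free_group by <:].

Lemma inv_letterK : involutive inv_letter.
Proof. by case=> i b; rewrite /inv_letter /= negbK. Qed.

Lemma push_reduced a w : reduced w -> reduced (push a w).
Proof.
case: w => [|b w] //= w_red.
by case: eqP => [_|/eqP ab]; [exact: path_sorted w_red|rewrite /= ab].
Qed.

Lemma pushK a w : reduced w -> push (inv_letter a) (push a w) = w.
Proof.
case: w => [|b w] /=; first by rewrite inv_letterK eqxx.
case: eqP => [->|_ _] /=; last by rewrite inv_letterK eqxx.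
by case: w => [|c w] //= /andP[/negbTE ->].
Qed.

Definition concat (u w : seq letter) : seq letter := foldr push w u.

Lemma concat_reduced u w : reduced w -> reduced (concat u w).
Proof. by move=> w_red; elim: u => //= a u; exact: push_reduced. Qed.

Lemma concat_push a u w : reduced w ->
  concat (push a u) w = push a (concat u w).
Proof.
move=> w_red; case: u => [|b u] //=; case: eqP => [->|_] //=.
by have := pushK (inv_letter a) (concat_reduced u w_red); rewrite inv_letterK.
Qed.

Lemma concatA u v w : reduced w -> concat u (concat v w) = concat (concat u v) w.
Proof.
by move=> w_red; elim: u => //= a u ->; rewrite concat_push.
Qed.

Lemma concat0 u : reduced u -> concat u [::] = u.
Proof.
elim: u => //= a u IH au_red; rewrite IH; last exact: path_sorted au_red.
by case: u {IH} au_red => [|b u] //= /andP[/negbTE ->].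
Qed.

Definition inv_word (u : seq letter) : seq letter := rev (map inv_letter u).

Lemma concat_inv_word u w : reduced w -> concat (inv_word u) (concat u w) = w.
Proof.
move=> w_red; elim: u => //= a u IH.
rewrite /inv_word /= rev_cons -cats1 /concat foldr_cat /=.
by rewrite pushK ?concat_reduced.
Qed.

Lemma inv_wordK : involutive inv_word.
Proof.
by move=> u; rewrite /inv_word map_rev revK -map_comp map_id_in // => a _;
  exact: inv_letterK.
Qed.

Lemma inv_word_reduced u : reduced u -> reduced (inv_word u).
Proof.
rewrite /reduced /inv_word rev_sorted sorted_map.
by apply: sub_sorted => a b /=; rewrite inv_letterK eq_sym.
Qed.

Definition fg_one : free_group := @FreeGroup [::] isT.
Definition fg_mul (x y : free_group) : free_group :=
  FreeGroup (concat_reduced (fg_word x) (fg_reduced y)).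
Definition fg_inv (x : free_group) : free_group :=
  FreeGroup (inv_word_reduced (fg_reduced x)).

Lemma fg_mulA : associative fg_mul.
Proof. by move=> x y z; apply/val_inj/concatA/fg_reduced. Qed.

Lemma fg_mul1 : left_id fg_one fg_mul.
Proof. by move=> x; exact/val_inj. Qed.

Lemma fg_mulr1 : right_id fg_one fg_mul.
Proof. by move=> x; apply/val_inj/concat0/fg_reduced. Qed.

Lemma fg_mulV : left_inverse fg_one fg_inv fg_mul.
Proof.
move=> [u u_red]; apply/val_inj => /=.
by rewrite -{2}(concat0 u_red) concat_inv_word.
Qed.

Lemma fg_mulrV : right_inverse fg_one fg_inv fg_mul.
Proof.
move=> x; rewrite -{1}[x](_ : fg_inv (fg_inv x) = x) ?fg_mulV //.
exact/val_inj/inv_wordK.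
Qed.

HB.instance Definition _ :=
  isGroup.Build free_group fg_mulA fg_mul1 fg_mulr1 fg_mulV fg_mulrV.

End FreeGroup.

Section RealNorm.
Context {R : realType} {V : normedModType R[i]}.

(* The norm of [V] takes its (real) values in [R[i]]. *)
Definition rnorm (x : V) : R := complex.Re `|x|.

End RealNorm.

(* The inner product is linear in its first argument. *)
Record hilbertSpace (R : realType) := HilbertSpace {
  hilbert_sort :> completeNormedModType R[i];
  hdot : {dot hilbert_sort for @Num.conj R[i]};
  hdotE : forall x, hdot x x = `|x| ^+ 2
}.

(* A unital C*-algebra. The joint structure of a complete normed module and an
   algebra does not exist in the library, so the product is a bilinear map. *)
Record cstarAlgebra (R : realType) := CStarAlgebra {
  cstar_sort :> completeNormedModType R[i];
  cmul : {bilinear cstar_sort -> cstar_sort -> cstar_sort};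
  cone : cstar_sort;
  cstar : cstar_sort -> cstar_sort;
  cmulA : forall x y z, cmul x (cmul y z) = cmul (cmul x y) z;
  cmul1 : forall x, cmul cone x = x;
  cmulr1 : forall x, cmul x cone = x;
  cstarK : forall x, cstar (cstar x) = x;
  cstar_antilinear : forall (a : R[i]) x y,
    cstar (a *: x + y) = Num.conj a *: cstar x + cstar y;
  cstarM : forall x y, cstar (cmul x y) = cmul (cstar y) (cstar x);
  cmul_norm : forall x y, `|cmul x y| <= `|x| * `|y|;
  cstar_norm : forall x, `|cmul (cstar x) x| = `|x| ^+ 2
}.
Arguments cone {R A} : rename.
Arguments cstar {R A} : rename.
Arguments cmul {R A} : rename.

Definition star_isomorphism (R : realType) (A B : cstarAlgebra R)
    (phi : {linear A -> B}) : Prop :=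
  [/\ bijective phi, phi cone = cone,
      forall x y, phi (cmul x y) = cmul (phi x) (phi y)
    & forall x, phi (cstar x) = cstar (phi x)].

Section GroupAlgebras.
Context {R : realType} {G : groupType}.
Local Notation C := R[i].
Local Notation CG := (malg G C).
(* [malg G C] is the space of finitely supported functions from [G] to [C],
   [mcoeff s f] the value of [f] at [s], [mkmalgU s c] the function [c] at [s],
   0 elsewhere. *)
Implicit Types (D : set (G -> C)) (N : CG -> \bar R) (f g : CG).

Definition conv f g : CG :=
  \sum_(s <- msupp f) \sum_(t <- msupp g) mkmalgU (s * t)%g (mcoeff s f * mcoeff t g).

Definition conv_star f : CG :=
  \sum_(s <- msupp f) mkmalgU s^-1%g (Num.conj (mcoeff s f)).

(* Each [rep s] is a surjective isometry, by [rep1] and [repM]. *)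
Record unitary_rep (H : hilbertSpace R) := UnitaryRep {
  rep :> G -> {linear H -> H};
  rep1 : forall x, rep 1%g x = x;
  repM : forall s t x, rep (s * t)%g x = rep s (rep t x);
  rep_unitary : forall s x y, hdot H (rep s x) (rep s y) = hdot H x y
}.

Definition coef (H : hilbertSpace R) (pi : unitary_rep H) (xi eta : H) :
  G -> C := fun s => hdot H (pi s xi) eta.

Definition rep_alg (H : hilbertSpace R) (pi : unitary_rep H) f (x : H) : H :=
  \sum_(s <- msupp f) mcoeff s f *: pi s x.

Definition D_representation D (H : hilbertSpace R) (pi : unitary_rep H) :=
  exists H0 : set H,
    [/\ H0 0, forall (a : C) x y, H0 x -> H0 y -> H0 (a *: x + y),
        dense H0 & forall xi eta, H0 xi -> H0 eta -> D (coef pi xi eta)].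

Definition opnorm (H : hilbertSpace R) (T : H -> H) : \bar R :=
  ereal_sup [set (rnorm (T x))%:E | x in [set x | rnorm x <= 1]].

(* The suprema are taken in [\bar R], where they always exist; they are in fact
   bounded by the l_1-norm of [f]. *)
Definition norm_D D f : \bar R :=
  ereal_sup [set c | exists (H : hilbertSpace R) (pi : unitary_rep H),
    D_representation D pi /\ c = opnorm (rep_alg pi f)].

Definition norm_full f : \bar R :=
  ereal_sup [set c | exists (H : hilbertSpace R) (pi : unitary_rep H),
    c = opnorm (rep_alg pi f)].

Definition ellp (p : \bar R) : set (G -> C) :=
  match p with
  | q%:E => [set u | summable [set: G] (fun s => (Normc.normc (u s) `^ q)%:E)]
  | +oo%E => [set u | exists M, forall s, Normc.normc (u s) <= M]
  | -oo%E => set0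
  end.

Definition ell2_norm (u : G -> C) : \bar R :=
  ((\esum_(s in [set: G]) (Normc.normc (u s) ^+ 2)%:E) `^ 2^-1)%E.

(* The left regular representation, [(lambda s xi) t = xi (s^-1 t)],
   extended to the group ring. *)
Definition lambda f (xi : G -> C) : G -> C :=
  fun t => \sum_(s <- msupp f) mcoeff s f * xi (s^-1 * t)%g.

Definition norm_reduced f : \bar R :=
  ereal_sup [set ell2_norm (lambda f xi) |
             xi in [set xi | (ell2_norm xi <= 1)%E]].

Definition Dplus (p : R) : set (G -> C) :=
  [set u | forall e : R, 0 < e -> ellp (p + e)%:E u].

Definition Dminus (p : \bar R) : set (G -> C) :=
  [set u | exists q : R, [/\ 1 <= q, (q%:E < p)%E & ellp q%:E u]].

Record cstar_completion N := CStarCompletion {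
  completion_sort :> cstarAlgebra R;
  emb : {linear CG -> completion_sort};
  emb1 : emb (mkmalgU 1%g 1) = cone;
  embM : forall f g, emb (conv f g) = cmul (emb f) (emb g);
  emb_star : forall f, emb (conv_star f) = cstar (emb f);
  emb_norm : forall f, (rnorm (emb f))%:E = N f;
  emb_dense : dense (range emb)
}.

(* The norms coincide, and the identity of the group ring extends to a
   *-isomorphism between the completions; these are determined up to such an
   isomorphism, whence the quantification over all models of them. *)
Definition canonically_isomorphic N1 N2 : Prop :=
  (forall f, N1 f = N2 f) /\
  forall (A : cstar_completion N1) (B : cstar_completion N2),
    exists phi : {linear A -> B},
      star_isomorphism phi /\ forall f, phi (emb A f) = emb B f.

End GroupAlgebras.

(* Main.v *)
From HB Require Import structures.
Require Import Defs.
From mathcomp Require Import all_boot all_order all_algebra finmap.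
From mathcomp Require Import complex sesquilinear.
From mathcomp Require Import all_classical all_reals all_analysis.
From mathcomp Require Import -(notations) monalg.
From mathcomp Require Import ring lra.

Set Implicit Arguments.
Unset Strict Implicit.
Unset Printing Implicit Defensive.

Import Order.TTheory GRing.Theory Num.Theory.
Import numFieldNormedType.Exports.

Local Open Scope classical_set_scope.
Local Open Scope ring_scope.

(** Why the theorem holds. An isometry of the group ring between two dense
    images extends to the completions, so everything reduces to equalities of
    norms ([canonically_isomorphic_of_eq]). The inclusions between the ideals
    give one inequality in each case ([norm_D_mono]).

    For the other, let [pi] be a representation with coefficients [phi] in the
    larger ideal. By Haagerup, [a ^+ wlen s] is positive definite on a free group
    for [0 < a < 1]: it is a coefficient of a unitary representation, and the
    tensor product of that representation with [pi] has the coefficients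
    [a ^+ wlen s * phi s]. Now [a ^+ wlen _] belongs to [ell_r] for some finite
    [r] ([ellp_wlen]), as the number of words of length [n] grows only
    exponentially, and by Hoelder's inequality multiplication by it lowers the
    exponent of summability: it sends [Dplus p] into [ell_p], and [ell_p] into
    [ell_q] for some [q < p]. So the tensor product is a representation for the
    smaller ideal, and as [a] tends to [1] its coefficients tend to those of [pi];
    this bounds the norm of [pi f] ([norm_D_le_of_decay]).

    The tensor product is realised on the square-summable functions from the
    group to the space of [pi]. As the group is free it is enough to give a
    unitary operator for each letter, inverse to that of the inverse letter
    ([free_rep]): the translation followed by a rotation in the plane of two
    coordinates ([twist_fun]). Reading off the component at the neutral element
    gives the factor [a ^+ wlen s] ([deform_vacuum]).

    For [p = 2] the norm is that of the regular representation. The regular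
    representation has finitely supported coefficients on a dense subspace
    ([norm_reduced_le]). Conversely, if the coefficient of [pi] at [xi] is
    square-summable, the norms of the vectors obtained by applying powers of
    [pi(f)^* pi(f)] to [xi] grow at most like the powers of the square of the
    reduced norm of [f], up to a constant, and by log-convexity this already
    bounds the first step ([ell2_coef_bound]). For [p = +oo] every
    representation is admissible, since coefficients are bounded
    ([norm_full_ellp]). *)

(** * Norms with real values *)

Local Notation cnorm := Normc.normc.

Section ComplexNumbers.
Variable R : realType.
Local Notation C := R[i].
Implicit Types (z w : C) (x : R).

Lemma cnormE z : `|z| = (cnorm z)%:C%C.
Proof. by case: z => a b; rewrite normc_def. Qed.

Lemma cnorm_ge0 z : 0 <= cnorm z.
Proof. by case: z => a b; rewrite sqrtr_ge0. Qed.

Lemma cnormD z w : cnorm (z + w) <= cnorm z + cnorm w.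
Proof. by rewrite -lecR rmorphD /= -!cnormE ler_normD. Qed.

Lemma cnormM z w : cnorm (z * w) = cnorm z * cnorm w.
Proof. exact: Normc.normcM. Qed.

Lemma cnorm0 : cnorm (0 : C) = 0.
Proof. exact: Normc.normc0. Qed.

Lemma cnorm_real x : cnorm (x%:C)%C = `|x|.
Proof. by rewrite /= expr0n /= addr0 sqrtr_sqr. Qed.

Lemma conjCE z : Num.conj z = conjc z.
Proof. by []. Qed.

Lemma cnorm_conj z : cnorm (Num.conj z) = cnorm z.
Proof. by apply: (@complexI R); rewrite -!cnormE norm_conjC. Qed.

Lemma Re_le_cnorm z : complex.Re z <= cnorm z.
Proof.
case: z => a b /=; rewrite (le_trans (ler_norm a))// -sqrtr_sqr ler_sqrt.
  by rewrite lerDl sqr_ge0.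
by rewrite addr_ge0 ?sqr_ge0.
Qed.

Lemma Re_norm_le_cnorm z : `|complex.Re z| <= cnorm z.
Proof.
case: z => a b /=; rewrite -sqrtr_sqr ler_sqrt ?lerDl ?sqr_ge0//.
by rewrite addr_ge0 ?sqr_ge0.
Qed.

Lemma Im_norm_le_cnorm z : `|complex.Im z| <= cnorm z.
Proof.
case: z => a b /=; rewrite -sqrtr_sqr ler_sqrt ?lerDr ?sqr_ge0//.
by rewrite addr_ge0 ?sqr_ge0.
Qed.

Lemma cnorm_le_ReIm z : cnorm z <= `|complex.Re z| + `|complex.Im z|.
Proof.
case: z => a b /=; rewrite -[leRHS]ger0_norm ?addr_ge0// -sqrtr_sqr ler_sqrt ?sqr_ge0//.
rewrite sqrrD !real_normK ?num_real//.
by have := mulr_ge0 (normr_ge0 a) (normr_ge0 b); lra.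
Qed.

Lemma ReD z w : complex.Re (z + w) = complex.Re z + complex.Re w.
Proof. by case: z w => a b []. Qed.
Lemma ImD z w : complex.Im (z + w) = complex.Im z + complex.Im w.
Proof. by case: z w => a b []. Qed.
Lemma ReB z w : complex.Re (z - w) = complex.Re z - complex.Re w.
Proof. by case: z w => a b []. Qed.
Lemma ImB z w : complex.Im (z - w) = complex.Im z - complex.Im w.
Proof. by case: z w => a b []. Qed.
Lemma ReM z w : complex.Re (z * w) =
  complex.Re z * complex.Re w - complex.Im z * complex.Im w.
Proof. by case: z w => a b []. Qed.
Lemma ImM z w : complex.Im (z * w) =
  complex.Re z * complex.Im w + complex.Im z * complex.Re w.
Proof. by case: z w => a b []. Qed.
Lemma Re_conj z : complex.Re (Num.conj z) = complex.Re z.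
Proof. by case: z. Qed.
Lemma Im_conj z : complex.Im (Num.conj z) = - complex.Im z.
Proof. by case: z. Qed.

Lemma complexP z w :
  complex.Re z = complex.Re w -> complex.Im z = complex.Im w -> z = w.
Proof. by case: z w => a b [c d] /= -> ->. Qed.

End ComplexNumbers.

Section RealNorm.
Variable R : realType.
Local Notation C := R[i].

Section Normed.
Variable V : normedModType C.
Implicit Types x y z : V.

Lemma rnormE x : `|x| = (rnorm x)%:C%C.
Proof. by rewrite /rnorm RRe_real ?normr_real. Qed.

Lemma rnorm_ge0 x : 0 <= rnorm x.
Proof. by rewrite -lecR -rnormE; exact: normr_ge0. Qed.

Lemma rnormD x y : rnorm (x + y) <= rnorm x + rnorm y.
Proof. by rewrite -lecR rmorphD /= -!rnormE ler_normD. Qed.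

Lemma rnormZ (a : C) x : rnorm (a *: x) = cnorm a * rnorm x.
Proof. by apply: (@complexI R); rewrite rmorphM /= -!rnormE normrZ cnormE. Qed.

Lemma rnorm0 : rnorm (0 : V) = 0.
Proof. by rewrite /rnorm normr0. Qed.

Lemma rnorm0_eq0 x : rnorm x = 0 -> x = 0.
Proof. by move=> x0; apply/eqP; rewrite -normr_eq0 rnormE x0. Qed.

Lemma rnormBC x y : rnorm (x - y) = rnorm (y - x).
Proof. by rewrite /rnorm distrC. Qed.

Lemma rnormB_trans x y z : rnorm (x - z) <= rnorm (x - y) + rnorm (y - z).
Proof. by rewrite -[x - z](_ : x - y + (y - z) = _) ?rnormD// addrA subrK. Qed.

Lemma rnorm_le_dist x y : rnorm x <= rnorm y + rnorm (x - y).
Proof. by rewrite -{1}(subrK y x) addrC rnormD. Qed.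

Lemma rnorm_sum (I : Type) (r : seq I) (F : I -> V) :
  rnorm (\sum_(i <- r) F i) <= \sum_(i <- r) rnorm (F i).
Proof.
elim/big_ind2: _ => [|z a w b Hz Hw|//]; first by rewrite rnorm0.
exact: le_trans (rnormD _ _) (lerD Hz Hw).
Qed.

Lemma ball_rnorm x y (e : R) : ball x (e%:C)%C y <-> rnorm (x - y) < e.
Proof. by rewrite -ball_normE /ball_ /= rnormE ltcR. Qed.

Lemma pos_complex (e : C) : 0 < e -> exists2 r : R, 0 < r & e = (r%:C)%C.
Proof.
by case: e => a b; rewrite ltcE /= => /andP[/eqP-> a0]; exists a.
Qed.

Lemma dense_rnorm (S : set V) :
  dense S <-> forall x (e : R), 0 < e -> exists2 y, S y & rnorm (x - y) < e.
Proof.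
split=> [dS x e e0|HS O [x Ox] oO].
  have [||y [By Sy]] := dS (ball x (e%:C)%C)°; last 1 first.
  - by exists y => //; apply/ball_rnorm; exact: interior_subset By.
  - exists x; apply: nbhsx_ballx; by rewrite ltcR.
  - exact: open_interior.
have /nbhs_ballP[_ /pos_complex[e e0 ->] eO] : nbhs x O by exact: open_nbhs_nbhs.
by have [y Sy xy] := HS x e e0; exists y; split=> //; apply/eO/ball_rnorm.
Qed.

End Normed.

Definition seq_cauchy (V : normedModType C) (u : nat -> V) :=
  forall e : R, 0 < e -> exists N, forall m n,
    (N <= m)%N -> (N <= n)%N -> rnorm (u m - u n) < e.
Definition seq_lim (V : normedModType C) (u : nat -> V) (l : V) :=
  forall e : R, 0 < e -> exists N, forall n, (N <= n)%N -> rnorm (u n - l) < e.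

Lemma seq_complete (V : completeNormedModType C) (u : nat -> V) :
  seq_cauchy u -> exists l, seq_lim u l.
Proof.
move=> cu; suff /cvg_ex[l ul] : cvg (u @ \oo).
  exists l => e e0; have e0' : 0 < (e%:C)%C :> C by rewrite ltcR.
  have /cvgrPdist_lt/(_ _ e0') [N _ HN] := ul.
  by exists N => n Nn; have := HN n Nn; rewrite /= rnormE ltcR rnormBC.
apply: cauchy_cvg; apply/cauchy_ballP => _ /pos_complex[e e0 ->].
have [N HN] := cu e e0.
exists ([set x | exists2 m, (N <= m)%N & x = u m],
        [set x | exists2 m, (N <= m)%N & x = u m]).
  by split; exists N => // n Nn; exists n.
by case=> x y [[m Nm /= ->] [n Nn /= ->]]; apply/ball_rnorm; exact: HN.
Qed.

(** Completeness along sequences suffices: a Cauchy filter contains balls of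
    radius [1 / (n + 1)], these meet pairwise, so their centres form a Cauchy
    sequence, and the filter converges to its limit. *)
Lemma complete_of_seq (V : normedModType C) :
  (forall u : nat -> V, seq_cauchy u -> exists l, seq_lim u l) ->
  forall F : set_system V, ProperFilter F -> cauchy F -> cvg F.
Proof.
move=> sc F FF /cauchyP cF.
have e0 (n : nat) : 0 < (n.+1%:R : R)^-1 by rewrite invr_gt0.
have /choice[u Fu] (n : nat) : exists x : V, F (ball x ((n.+1%:R : R)^-1%:C)%C).
  by apply: cF; rewrite ltcR.
have udist m n : rnorm (u m - u n) < (m.+1%:R)^-1 + (n.+1%:R)^-1.
  have [y [/ball_rnorm my /ball_rnorm ny]] := filter_ex (filterI (Fu m) (Fu n)).
  rewrite (le_lt_trans (rnormB_trans _ y _))// ltrD//.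
  by rewrite rnormBC.
have small (e : R) : 0 < e -> exists N, forall n, (N <= n)%N -> (n.+1%:R : R)^-1 < e.
  move=> ep; have [N _ HN] := near_infty_natSinv_lt (PosNum ep).
  by exists N => n Nn; exact: HN.
have [|l ul] := sc u.
  move=> e ep; have [N HN] := small _ (divr_gt0 ep (ltr0n R 2)).
  exists N => m n Nm Nn; rewrite (lt_trans (udist m n))//.
  by rewrite [e]splitr ltrD ?HN.
apply/cvg_ex; exists l; apply/cvg_ballP => _ /pos_complex[e ep ->].
have [N HN] := small _ (divr_gt0 ep (ltr0n R 2)).
have [N' HN'] := ul _ (divr_gt0 ep (ltr0n R 2)).
apply: filterS (Fu (maxn N N')) => y /ball_rnorm ny; apply/ball_rnorm.
rewrite (le_lt_trans (rnormB_trans _ (u (maxn N N')) _))// [e]splitr ltrD//.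
  by rewrite rnormBC HN' ?leq_maxr.
by rewrite (lt_trans ny)// HN ?leq_maxl.
Qed.

End RealNorm.

(** * Inner products *)

Section DotForm.
Variables (R : realType) (U : lmodType R[i]) (f : {dot U for @Num.conj R[i]}).
Local Notation C := R[i].
Implicit Types (x y z : U) (a : C).

Lemma dotDl x y z : f (x + y) z = f x z + f y z.
Proof. exact: linearDl. Qed.
Lemma dotBl x y z : f (x - y) z = f x z - f y z.
Proof. exact: linearBl. Qed.
Lemma dotNl x z : f (- x) z = - f x z.
Proof. exact: linearNl. Qed.
Lemma dotNr x z : f z (- x) = - f z x.
Proof. exact: linearNr. Qed.
Lemma dotZl a x z : f (a *: x) z = a * f x z.
Proof. exact: linearZl_LR. Qed.
Lemma dot0l z : f 0 z = 0.
Proof. exact: linear0l. Qed.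
Lemma dotC x y : f x y = Num.conj (f y x).
Proof. by rewrite hermC /= expr0 mul1r. Qed.
Lemma dotDr x y z : f z (x + y) = f z x + f z y.
Proof. exact: linearDr. Qed.
Lemma dotBr x y z : f z (x - y) = f z x - f z y.
Proof. exact: linearBr. Qed.
Lemma dotZr a x z : f z (a *: x) = Num.conj a * f z x.
Proof. exact: linearZr_LR. Qed.
Lemma dot0r z : f z 0 = 0.
Proof. exact: linear0r. Qed.
Lemma dot_suml (I : Type) (r : seq I) (F : I -> U) z :
  f (\sum_(i <- r) F i) z = \sum_(i <- r) f (F i) z.
Proof.
elim: r => [|i r IH]; first by rewrite !big_nil dot0l.
by rewrite !big_cons dotDl IH.
Qed.
Lemma dot_sumr (I : Type) (r : seq I) (F : I -> U) z :
  f z (\sum_(i <- r) F i) = \sum_(i <- r) f z (F i).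
Proof.
elim: r => [|i r IH]; first by rewrite !big_nil dot0r.
by rewrite !big_cons dotDr IH.
Qed.

Definition sqn x : R := complex.Re (f x x).

Lemma sqnE x : f x x = (sqn x)%:C%C.
Proof. by rewrite /sqn RRe_real// ger0_real// dnorm_ge0. Qed.

Lemma sqn_ge0 x : 0 <= sqn x.
Proof. by rewrite -lecR -sqnE dnorm_ge0. Qed.

Lemma sqn_eq0 x : sqn x = 0 -> x = 0.
Proof. by move=> x0; apply/eqP; rewrite -(dnorm_eq0 f) sqnE x0. Qed.

Lemma cnorm_dot_sqr x y : cnorm (f x y) ^+ 2 <= sqn x * sqn y.
Proof.
have [y0|y0] := eqVneq (sqn y) 0.
  by rewrite y0 mulr0 (sqn_eq0 y0) dot0r cnorm0 expr0n.
have y1 : 0 < sqn y by rewrite lt_neqAle eq_sym y0 sqn_ge0.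
(* the component of [x] orthogonal to [y], scaled by [f y y] *)
have := sqn_ge0 (f y y *: x - f x y *: y).
rewrite -lecR -sqnE !(dotBl, dotBr, dotZl, dotZr) (dotC y x) !sqnE.
set z := f x y; set a := sqn x; set b := sqn y.
have -> : Num.conj (b%:C)%C = (b%:C)%C by rewrite conjCE conjc_real.
have zz : z * Num.conj z = ((cnorm z) ^+ 2)%:C%C.
  by rewrite -normCK cnormE -rmorphXn.
rewrite [X in _ <= X](_ : _ = (b%:C * b%:C * a%:C - b%:C * (z * Num.conj z))%C).
  rewrite zz -!rmorphM -rmorphB lecR -mulrA -mulrBr pmulr_rge0// subr_ge0.
  by rewrite [a * b]mulrC.
ring.
Qed.

End DotForm.

Section Hilbert.
Variables (R : realType) (H : hilbertSpace R).
Local Notation C := R[i].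
Implicit Types (x y z : H).

Lemma sqn_hdot x : sqn (hdot H) x = rnorm x ^+ 2.
Proof. by apply: (@complexI R); rewrite -sqnE hdotE rnormE -rmorphXn. Qed.

Lemma cauchy_schwarz x y : cnorm (hdot H x y) <= rnorm x * rnorm y.
Proof.
rewrite -ler_sqr ?nnegrE ?mulr_ge0 ?cnorm_ge0 ?rnorm_ge0//.
by rewrite exprMn -!sqn_hdot cnorm_dot_sqr.
Qed.

Lemma rnorm_le_dot x (c : R) : 0 <= c ->
  (forall y, cnorm (hdot H x y) <= c * rnorm y) -> rnorm x <= c.
Proof.
move=> c0 /(_ x); rewrite hdotE rnormE -rmorphXn cnorm_real ger0_norm ?exprn_ge0 ?rnorm_ge0//.
rewrite expr2; have [x0|x0] := eqVneq (rnorm x) 0; first by rewrite x0.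
by rewrite ler_pM2r// lt_neqAle eq_sym x0 rnorm_ge0.
Qed.

End Hilbert.

Lemma eq_rnorm_sqn (R : realType) (H K : hilbertSpace R) (x : H) (y : K) :
  hdot H x x = hdot K y y -> rnorm x = rnorm y.
Proof.
move=> xy; apply/eqP; rewrite -(eqrXn2 (n:=2))// ?rnorm_ge0//.
by rewrite -!sqn_hdot /sqn xy.
Qed.

(** * Sums of summable families *)

Section PositiveSums.
Variables (R : realType) (T : choiceType).
Implicit Types (g h : T -> R).

Definition psummable g := (\esum_(t in [set: T]) (g t)%:E < +oo)%E.
Definition psum g : R := fine (\esum_(t in [set: T]) (g t)%:E).

Lemma psumE g : (forall t, 0 <= g t) -> psummable g ->
  (\esum_(t in [set: T]) (g t)%:E = (psum g)%:E)%E.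
Proof.
move=> g0 gs; rewrite fineK// ge0_fin_numE//.
by apply: esum_ge0 => t _; rewrite lee_fin.
Qed.

Lemma psum_ge0 g : (forall t, 0 <= g t) -> 0 <= psum g.
Proof. by move=> g0; apply/fine_ge0/esum_ge0 => t _; rewrite lee_fin. Qed.

Lemma esum_le_fset g (M : R) :
  (forall X : {fset T}, \sum_(t <- X) g t <= M) ->
  (\esum_(t in [set: T]) (g t)%:E <= M%:E)%E.
Proof.
move=> HM; apply: ge_ereal_sup => _ [A [finA _] <-].
by rewrite fsbig_finite//= sumEFin lee_fin.
Qed.

Lemma psum_le_fset g (M : R) : (forall t, 0 <= g t) ->
  (forall X : {fset T}, \sum_(t <- X) g t <= M) -> psummable g /\ psum g <= M.
Proof.
move=> g0 /esum_le_fset HM; have gs : psummable g by exact: le_lt_trans HM (ltry _).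
by split=> //; rewrite -lee_fin -psumE.
Qed.

Lemma psum_ge_fset g (X : {fset T}) : (forall t, 0 <= g t) -> psummable g ->
  \sum_(t <- X) g t <= psum g.
Proof.
move=> g0 gs; rewrite -lee_fin -psumE// -sumEFin.
apply: esum_ge; exists [set` X]; first by split=> //; exact: finite_fset.
by rewrite fsbig_finite//= set_fsetK.
Qed.

Lemma psum_ge1 g t : (forall t, 0 <= g t) -> psummable g -> g t <= psum g.
Proof. by move=> g0 /(psum_ge_fset [fset t]%fset g0); rewrite big_seq_fset1. Qed.

Lemma psummable_le g h :
  (forall t, g t <= h t) -> psummable h -> psummable g.
Proof.
by move=> gh; apply: le_lt_trans; apply: le_esum => t _; rewrite lee_fin.
Qed.

Lemma psummableD g h : (forall t, 0 <= g t) -> (forall t, 0 <= h t) ->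
  psummable g -> psummable h -> psummable (fun t => g t + h t).
Proof.
move=> g0 h0 gs hs; rewrite /psummable.
under eq_esum do rewrite EFinD.
by rewrite esumD ?lte_add_pinfty// => t _; rewrite lee_fin.
Qed.

Lemma psumD g h : (forall t, 0 <= g t) -> (forall t, 0 <= h t) ->
  psummable g -> psummable h -> psum (fun t => g t + h t) = psum g + psum h.
Proof.
move=> g0 h0 gs hs; apply: EFin_inj; rewrite EFinD -!psumE//.
- rewrite -esumD; [|by move=> t _; rewrite lee_fin..].
  by apply: eq_esum => t _; rewrite EFinD.
- by move=> t; rewrite addr_ge0.
- exact: psummableD.
Qed.

Lemma psumZ g (k : R) : (forall t, 0 <= g t) -> 0 <= k -> psummable g ->
  psummable (fun t => k * g t) /\ psum (fun t => k * g t) = k * psum g.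
Proof.
move=> g0 k0 gs.
have [|X|ks kle] := @psum_le_fset (fun t => k * g t) (k * psum g).
- by move=> t; rewrite mulr_ge0.
- by rewrite -mulr_sumr ler_wpM2l// psum_ge_fset.
split=> //; apply/eqP; rewrite eq_le kle /=.
have [->|kN0] := eqVneq k 0; first by rewrite mul0r psum_ge0// => t; rewrite mul0r.
have k1 : 0 < k by rewrite lt_neqAle eq_sym kN0.
rewrite mulrC -ler_pdivlMr//; have [//|X|//] := @psum_le_fset g (psum (fun t => k * g t) / k).
rewrite ler_pdivlMr// mulr_suml; under eq_bigr do rewrite mulrC.
by apply: (@psum_ge_fset (fun t => k * g t)) => // t; rewrite mulr_ge0.
Qed.

Lemma psum0 : psum (fun=> 0) = 0.
Proof. by rewrite /psum esum1. Qed.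

Lemma psum_supp g (X : {fset T}) : (forall t, 0 <= g t) ->
  (forall t, t \notin X -> g t = 0) ->
  psummable g /\ psum g = \sum_(t <- X) g t.
Proof.
move=> g0 gX; have [//|Y|gs gle] := @psum_le_fset g (\sum_(t <- X) g t).
  rewrite (bigID (mem X)) /= [X in _ + X]big1 ?addr0; last by move=> t /gX.
  rewrite -big_filter (perm_big [seq t <- X | t \in Y]) /=; last first.
    apply: uniq_perm; rewrite ?filter_uniq ?fset_uniq// => t.
    by rewrite !mem_filter andbC.
  rewrite big_filter [leRHS](bigID (mem Y)) /= lerDl.
  by apply: sumr_ge0.
by split=> //; apply/eqP; rewrite eq_le gle psum_ge_fset.
Qed.

End PositiveSums.

Section RealSums.
Variables (R : realType) (T : choiceType).
Local Notation C := R[i].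
Implicit Types (g h : T -> R).

Definition asummable g := psummable (fun t => `|g t|).

(** Both families on the right are nonnegative, so that their sums are suprema
    over finite subsets and no order of summation has to be chosen. *)
Definition rsum g := psum (fun t => `|g t| + g t) - psum (fun t => `|g t|).

Let abs_add_ge0 (x : R) : 0 <= `|x| + x.
Proof. by rewrite -lerBlDr sub0r (le_trans (ler_norm _))// normrN. Qed.

Let abs_add_summable g : asummable g -> psummable (fun t => `|g t| + g t).
Proof.
move=> gs; apply: (@psummable_le _ _ _ (fun t => `|g t| + `|g t|)).
  by move=> t; rewrite lerD2l ler_norm.
exact: psummableD.
Qed.

(** Any way of writing [g] as a difference of nonnegative summable families
    computes its sum; linearity follows by exhibiting such differences. *)
Lemma rsum_sub a b g : (forall t, 0 <= a t) -> (forall t, 0 <= b t) ->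
  psummable a -> psummable b -> (forall t, g t = a t - b t) ->
  asummable g /\ rsum g = psum a - psum b.
Proof.
move=> a0 b0 sa sb gab; have gs : asummable g.
  apply: (@psummable_le _ _ _ (fun t => a t + b t)); last exact: psummableD.
  move=> t; rewrite gab (le_trans (ler_normB _ _))//.
  by rewrite !ger0_norm.
split=> //; rewrite /rsum.
suff : psum (fun t => `|g t| + g t) + psum b = psum a + psum (fun t => `|g t|).
  lra.
rewrite -(psumD (fun t => abs_add_ge0 (g t)) b0 (abs_add_summable gs) sb).
by rewrite -psumD//; congr psum; apply/funext => t; rewrite gab; lra.
Qed.

Lemma rsumD g h : asummable g -> asummable h ->
  asummable (fun t => g t + h t) /\ rsum (fun t => g t + h t) = rsum g + rsum h.
Proof.
move=> gs hs.
have [||||t|s ->] := @rsum_sub (fun t => (`|g t| + g t) + (`|h t| + h t))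
  (fun t => `|g t| + `|h t|) (fun t => g t + h t).
- by move=> t; rewrite addr_ge0.
- by move=> t; rewrite addr_ge0.
- by apply: psummableD => //; exact: abs_add_summable.
- exact: psummableD.
- lra.
split=> //; rewrite (psumD _ _ gs hs)//.
rewrite (psumD (fun t => abs_add_ge0 (g t)) (fun t => abs_add_ge0 (h t)))//.
- by rewrite /rsum; lra.
- exact: abs_add_summable.
- exact: abs_add_summable.
Qed.

Lemma rsumZ (k : R) g : asummable g ->
  asummable (fun t => k * g t) /\ rsum (fun t => k * g t) = k * rsum g.
Proof.
move=> gs; have gs' := abs_add_summable gs.
have [k0|k0] := leP 0 k.
  have [s1 e1] := psumZ (fun t => abs_add_ge0 (g t)) k0 gs'.
  have [s2 e2] := psumZ (fun t => normr_ge0 (g t)) k0 gs.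
  have [||t|s ->] := rsum_sub (g := fun t => k * g t) _ _ s1 s2.
  - by move=> t; rewrite mulr_ge0.
  - by move=> t; rewrite mulr_ge0.
  - by ring.
  by split=> //; rewrite e1 e2 -mulrBr.
have k1 : 0 <= - k by rewrite oppr_ge0 ltW.
have [s1 e1] := psumZ (fun t => abs_add_ge0 (g t)) k1 gs'.
have [s2 e2] := psumZ (fun t => normr_ge0 (g t)) k1 gs.
have [||t|s ->] := rsum_sub (g := fun t => k * g t) _ _ s2 s1.
- by move=> t; rewrite mulr_ge0.
- by move=> t; rewrite mulr_ge0.
- by ring.
by split=> //; rewrite e1 e2 /rsum; ring.
Qed.

Lemma rsum_ge0E g : (forall t, 0 <= g t) -> psummable g -> rsum g = psum g.
Proof.
move=> g0 gs; have [//|//|//||t|_ ->] := @rsum_sub g (fun=> 0) g.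
- by rewrite /psummable esum1 ?ltry.
- by rewrite subr0.
by rewrite psum0 subr0.
Qed.

Definition csum (g : T -> C) : C :=
  Complex (rsum (fun t => complex.Re (g t))) (rsum (fun t => complex.Im (g t))).

Definition csummable (g : T -> C) := psummable (fun t => cnorm (g t)).

Lemma csummable_Re (g : T -> C) :
  csummable g -> asummable (fun t => complex.Re (g t)).
Proof. by apply: psummable_le => t; exact: Re_norm_le_cnorm. Qed.

Lemma csummable_Im (g : T -> C) :
  csummable g -> asummable (fun t => complex.Im (g t)).
Proof. by apply: psummable_le => t; exact: Im_norm_le_cnorm. Qed.

Lemma csumD (g h : T -> C) : csummable g -> csummable h ->
  csum (fun t => g t + h t) = csum g + csum h.
Proof.
move=> gs hs; apply: complexP => /=.
  have [_ <-] := rsumD (csummable_Re gs) (csummable_Re hs).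
  by congr rsum; apply/funext => t; rewrite ReD.
have [_ <-] := rsumD (csummable_Im gs) (csummable_Im hs).
by congr rsum; apply/funext => t; rewrite ImD.
Qed.

Lemma csumZ (a : C) (g : T -> C) : csummable g ->
  csum (fun t => a * g t) = a * csum g.
Proof.
move=> gs; have gr := csummable_Re gs; have gi := csummable_Im gs.
apply: complexP; rewrite !(ReM, ImM) /csum /=.
  have [s1 e1] := rsumZ (complex.Re a) gr.
  have [s2 e2] := rsumZ (- complex.Im a) gi.
  rewrite -e1 -mulNr -e2; have [_ <-] := rsumD s1 s2.
  by congr rsum; apply/funext => t; rewrite ReM mulNr.
have [s1 e1] := rsumZ (complex.Re a) gi.
have [s2 e2] := rsumZ (complex.Im a) gr.
rewrite -e1 -e2; have [_ <-] := rsumD s1 s2.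
by congr rsum; apply/funext => t; rewrite ImM.
Qed.

Lemma csum_conj (g : T -> C) : csummable g ->
  csum (fun t => Num.conj (g t)) = Num.conj (csum g).
Proof.
move=> gs; apply: complexP; rewrite ?Re_conj ?Im_conj /=.
  by congr rsum; apply/funext => t; rewrite Re_conj.
have [_ /esym] := rsumZ (-1) (csummable_Im gs); rewrite mulN1r => ->.
by congr rsum; apply/funext => t; rewrite Im_conj mulN1r.
Qed.

Lemma csum_ge0E g : (forall t, 0 <= g t) -> psummable g ->
  csum (fun t => (g t)%:C%C) = (psum g)%:C%C.
Proof.
move=> g0 gs; apply: complexP => /=; first by rewrite rsum_ge0E.
by rewrite rsum_ge0E ?psum0// /psummable esum1 ?ltry.
Qed.

Lemma csum1 (g : T -> C) (s : T) : (forall t, t != s -> g t = 0) ->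
  csum g = g s.
Proof.
have r1 (h : T -> R) : (forall t, t != s -> h t = 0) -> rsum h = h s.
  move=> h0; have p1 (k : T -> R) : (forall t, 0 <= k t) ->
      (forall t, t != s -> k t = 0) -> psum k = k s.
    move=> k0 ks; have [t|_ ->] := @psum_supp _ _ k [fset s]%fset k0.
      by rewrite inE; exact: ks.
    by rewrite big_seq_fset1.
  have e1 : psum (fun t => `|h t| + h t) = `|h s| + h s.
    apply: p1 => [t|t /h0 ->]; first exact: abs_add_ge0.
    by rewrite normr0 addr0.
  have e2 : psum (fun t => `|h t|) = `|h s|.
    by apply: p1 => [t|t /h0 ->]; rewrite ?normr0 ?normr_ge0.
  by rewrite /rsum e1 e2; ring.
move=> gs; apply: complexP => /=.
  by rewrite (r1 (fun t => complex.Re (g t)))// => t /gs ->.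
by rewrite (r1 (fun t => complex.Im (g t)))// => t /gs ->.
Qed.

End RealSums.

(** * Square-summable functions with values in a Hilbert space *)

Section NormOfDot.
Variables (R : realType) (U : lmodType R[i]) (f : {dot U for @Num.conj R[i]}).
Local Notation C := R[i].

Definition dot_norm (x : U) : C := (Num.sqrt (sqn f x))%:C%C.

Lemma dot_norm_sqr x : dot_norm x ^+ 2 = f x x.
Proof. by rewrite /dot_norm -rmorphXn /= sqr_sqrtr ?sqn_ge0// sqnE. Qed.

Lemma dot_normD x y : dot_norm (x + y) <= dot_norm x + dot_norm y.
Proof.
rewrite /dot_norm -rmorphD lecR -ler_sqr ?nnegrE ?addr_ge0 ?sqrtr_ge0//.
rewrite sqrrD !sqr_sqrtr ?sqn_ge0// -sqrtrM ?sqn_ge0//.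
have -> : sqn f (x + y) = sqn f x + complex.Re (f x y) *+ 2 + sqn f y.
  by rewrite /sqn dotDl !dotDr (dotC _ y x) !ReD Re_conj; ring.
rewrite lerD2r lerD2l lerMn2r /= (le_trans (Re_le_cnorm _))//.
by rewrite -(ger0_norm (cnorm_ge0 _)) -sqrtr_sqr ler_wsqrtr ?cnorm_dot_sqr.
Qed.

Lemma dot_normZ (a : C) x : dot_norm (a *: x) = `|a| * dot_norm x.
Proof.
rewrite /dot_norm cnormE -rmorphM; congr (_%:C)%C.
have -> : sqn f (a *: x) = cnorm a ^+ 2 * sqn f x.
  apply: (@complexI R); rewrite -sqnE dotZl dotZr rmorphM rmorphXn /= -cnormE.
  by rewrite normCK -sqnE mulrA.
by rewrite sqrtrM ?exprn_ge0 ?cnorm_ge0// sqrtr_sqr ger0_norm ?cnorm_ge0.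
Qed.

Lemma dot_norm0_eq0 x : dot_norm x = 0 -> x = 0.
Proof.
by move=> /(congr1 (fun z => z ^+ 2)); rewrite dot_norm_sqr expr0n /= sqnE => -[/sqn_eq0].
Qed.

End NormOfDot.

Section L2.
Variables (R : realType) (T : choiceType) (H : hilbertSpace R).
Local Notation C := R[i].

Definition l2fun : {pred T -> H} := fun u => `[<psummable (fun t => rnorm (u t) ^+ 2)>].

Lemma l2funP (u : T -> H) : reflect (psummable (fun t => rnorm (u t) ^+ 2)) (u \in l2fun).
Proof. exact: asboolP. Qed.

Lemma sqr_rnormD (x y : H) : rnorm (x + y) ^+ 2 <= 2 * (rnorm x ^+ 2) + 2 * (rnorm y ^+ 2).
Proof.
have := sqr_ge0 (rnorm x - rnorm y).
have := rnormD x y; rewrite -ler_sqr ?nnegrE ?addr_ge0 ?rnorm_ge0//.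
nra.
Qed.

Lemma l2fun_submod : submod_closed l2fun.
Proof.
split=> [|a u v /l2funP su /l2funP sv]; apply/l2funP.
  by rewrite /psummable esum1 ?ltry// => t _; rewrite rnorm0 expr0n.
have s1 : psummable (fun t => 2 * cnorm a ^+ 2 * rnorm (u t) ^+ 2).
  apply: (psumZ _ _ su).1 => [t|]; first by rewrite exprn_ge0 ?rnorm_ge0.
  by rewrite mulr_ge0 ?exprn_ge0 ?cnorm_ge0.
have s2 : psummable (fun t => 2 * rnorm (v t) ^+ 2).
  by apply: (psumZ _ _ sv).1 => // t; rewrite exprn_ge0 ?rnorm_ge0.
apply: psummable_le (psummableD _ _ s1 s2) => t.
- by rewrite (le_trans (sqr_rnormD _ _))// rnormZ exprMn mulrA.
- by rewrite !mulr_ge0 ?exprn_ge0 ?cnorm_ge0 ?rnorm_ge0.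
- by rewrite mulr_ge0 ?exprn_ge0 ?cnorm_ge0 ?rnorm_ge0.
Qed.

HB.instance Definition _ := GRing.isSubmodClosed.Build C (T -> H) l2fun l2fun_submod.

Record l2 : Type := MkL2 { l2val : T -> H; l2valP : l2val \in l2fun }.
HB.instance Definition _ := [isSub for l2val].
HB.instance Definition _ := [Choice of l2 by <:].
HB.instance Definition _ := [SubChoice_isSubLmodule of l2 by <:].

Implicit Types (u v w : l2).

Lemma l2D u v t : l2val (u + v) t = l2val u t + l2val v t.
Proof. by []. Qed.
Lemma l2B u v t : l2val (u - v) t = l2val u t - l2val v t.
Proof. by []. Qed.
Lemma l2Z a u t : l2val (a *: u) t = a *: l2val u t.
Proof. by []. Qed.

Lemma l2_ext u v : (forall t, l2val u t = l2val v t) -> u = v.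
Proof. by move=> uv; apply: val_inj; exact/funext. Qed.

Lemma l2_summable u : psummable (fun t => rnorm (l2val u t) ^+ 2).
Proof. exact/l2funP/l2valP. Qed.

Lemma l2_dot_summable u v : csummable (fun t => hdot H (l2val u t) (l2val v t)).
Proof.
apply: psummable_le (psummableD _ _ (l2_summable u) (l2_summable v)) => t;
  rewrite ?exprn_ge0 ?rnorm_ge0//.
rewrite (le_trans (cauchy_schwarz _ _))//.
have := rnorm_ge0 (l2val u t); have := rnorm_ge0 (l2val v t); nra.
Qed.

Definition l2dot u v : C := csum (fun t => hdot H (l2val u t) (l2val v t)).

Lemma l2dot_linear v : linear_for *%R (fun u => l2dot u v).
Proof.
move=> a u w; rewrite /l2dot -csumZ; last exact: l2_dot_summable.
rewrite -csumD; [|have := l2_dot_summable (a *: u) v|exact: l2_dot_summable].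
  by congr csum; apply/funext => t; rewrite l2D l2Z dotDl dotZl.
by apply: psummable_le => t; rewrite l2Z dotZl.
Qed.

Lemma l2dotC u v : l2dot u v = Num.conj (l2dot v u).
Proof.
rewrite /l2dot -csum_conj; last exact: l2_dot_summable.
by congr csum; apply/funext => t; rewrite dotC.
Qed.

Lemma l2dot_linearr u : linear_for (Num.conj \; *%R) (l2dot u).
Proof.
move=> a v w; rewrite l2dotC l2dot_linear rmorphD rmorphM /=.
by rewrite -!l2dotC.
Qed.

Lemma l2dotE u : l2dot u u = (psum (fun t => rnorm (l2val u t) ^+ 2))%:C%C.
Proof.
rewrite -csum_ge0E; last exact: l2_summable.
  by congr csum; apply/funext => t; rewrite hdotE rnormE -rmorphXn.
by move=> t; rewrite exprn_ge0 ?rnorm_ge0.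
Qed.

HB.instance Definition _ := @bilinear_isBilinear.Build C l2 l2 C *%R (Num.conj \; *%R)
  l2dot (l2dot_linear, l2dot_linearr).

Lemma l2dot_hermitian u v : l2dot u v = (-1) ^+ false * Num.conj (l2dot v u).
Proof. by rewrite expr0 mul1r; exact: l2dotC. Qed.

HB.instance Definition _ := @isHermitianSesquilinear.Build C l2 false (@Num.conj C)
  l2dot l2dot_hermitian.

Lemma l2dot_gt0 u : u != 0 -> 0 < l2dot u u.
Proof.
move=> u0; have rn0 t : 0 <= rnorm (l2val u t) ^+ 2 by rewrite exprn_ge0 ?rnorm_ge0.
rewrite l2dotE ltcR lt_neqAle psum_ge0// andbT eq_sym.
apply: contra_neq u0 => us; apply: l2_ext => t; apply: rnorm0_eq0.
have : rnorm (l2val u t) ^+ 2 == 0.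
  by rewrite eq_le rn0 andbT -us (psum_ge1 t rn0 (l2_summable u)).
by rewrite expf_eq0 => /eqP.
Qed.

HB.instance Definition _ := @isDotProduct.Build C l2 l2dot l2dot_gt0.

HB.instance Definition _ := @Lmodule_isNormed.Build C l2 (dot_norm l2dot)
  (dot_normD l2dot) (dot_normZ l2dot) (@dot_norm0_eq0 _ _ l2dot).

Lemma l2_rnorm_sqr u : rnorm u ^+ 2 = psum (fun t => rnorm (l2val u t) ^+ 2).
Proof.
apply: (@complexI R); rewrite -l2dotE -(dot_norm_sqr l2dot) rmorphXn /=.
by rewrite -rnormE.
Qed.

Lemma rnorm_sqr_ge0 (V : normedModType C) (x : V) : 0 <= rnorm x ^+ 2.
Proof. by rewrite exprn_ge0 ?rnorm_ge0. Qed.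

Lemma rnorm_l2val u t : rnorm (l2val u t) <= rnorm u.
Proof.
rewrite -ler_sqr ?nnegrE ?rnorm_ge0// l2_rnorm_sqr.
exact: (psum_ge1 t (fun t => rnorm_sqr_ge0 (l2val u t)) (l2_summable u)).
Qed.

(** A Cauchy sequence converges at each point. Finite partial sums of the
    distance to the pointwise limit are bounded by passing through a late term of
    the sequence, chosen after the finite set of points; the bound does not depend
    on that set, so it holds for the whole sum. *)
Lemma l2_seq_complete (u : nat -> l2) : seq_cauchy u -> exists w, seq_lim u w.
Proof.
move=> cu; have /choice[w uw] t : exists l, seq_lim (fun n => l2val (u n) t) l.
  apply: seq_complete => e e0; have [N HN] := cu e e0.
  by exists N => m n Nm Nn; rewrite (le_lt_trans (rnorm_l2val (u m - u n) t))// HN.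
have lim_fin (X : seq T) (e : R) : 0 < e -> exists N, forall n, (N <= n)%N ->
    \sum_(t <- X) rnorm (l2val (u n) t - w t) ^+ 2 <= e.
  elim: X e => [|t X IH] e e0; first by exists 0 => n _; rewrite big_nil ltW.
  have e2 : 0 < e / 2 by rewrite divr_gt0.
  have s2 : 0 < Num.sqrt (e / 2) by rewrite sqrtr_gt0.
  have [N HN] := IH _ e2; have [M HM] := uw t _ s2.
  exists (maxn N M) => n; rewrite geq_max big_cons => /andP[Nn Mn].
  rewrite [e]splitr; apply: lerD; last exact: HN.
  rewrite -[e / 2]sqr_sqrtr ?(ltW e2)// ler_sqr ?nnegrE ?rnorm_ge0 ?sqrtr_ge0//.
  by rewrite ltW ?HM.
(* the factor 4 is what [sqr_rnormD] costs: twice the distance to the late term,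
   twice the distance from there to the limit *)
have close (e : R) : 0 < e -> exists N, forall n, (N <= n)%N ->
    forall X : {fset T}, \sum_(t <- X) rnorm (l2val (u n) t - w t) ^+ 2 <= 4 * e ^+ 2.
  move=> e0; have [N HN] := cu e e0; exists N => n Nn X.
  have [M HM] := lim_fin X _ (exprn_gt0 2 e0).
  pose m := maxn N M; have Nm : (N <= m)%N by rewrite leq_maxl.
  apply: (@le_trans _ _ (\sum_(t <- X) (2 * rnorm (l2val (u n - u m) t) ^+ 2 +
                                        2 * rnorm (l2val (u m) t - w t) ^+ 2))).
    apply: ler_sum => t _; rewrite (le_trans _ (sqr_rnormD _ _))//.
    by rewrite l2B addrA subrK.
  rewrite big_split /= -!mulr_sumr.
  have h1 : \sum_(t <- X) rnorm (l2val (u n - u m) t) ^+ 2 <= e ^+ 2.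
    apply: le_trans (psum_ge_fset X (fun t => rnorm_sqr_ge0 _) (l2_summable _)) _.
    by rewrite -l2_rnorm_sqr ler_sqr ?nnegrE ?rnorm_ge0 ?ltW ?HN.
  by have := HM m (leq_maxr _ _); lra.
have wl2 : w \in l2fun.
  have [N /(_ N (leqnn _)) HN] := close 1 ltr01.
  have [dl2 _] := psum_le_fset (fun t => rnorm_sqr_ge0 (l2val (u N) t - w t)) HN.
  have wd : (fun t => l2val (u N) t - w t) \in l2fun by apply/l2funP.
  rewrite (_ : w = l2val (u N) - (fun t => l2val (u N) t - w t)); last first.
    by apply/funext => t /=; rewrite opprB addrC subrK.
  by rewrite rpredB ?l2valP.
exists (MkL2 wl2) => e e0; have [N HN] := close _ (divr_gt0 e0 (ltr0n R 3)).
exists N => n /HN{}HN; rewrite -ltr_sqr ?nnegrE ?rnorm_ge0 ?ltW// l2_rnorm_sqr.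
have [_ /le_lt_trans] := psum_le_fset (fun t => rnorm_sqr_ge0 (l2val (u n) t - w t)) HN.
apply; rewrite -subr_gt0 (_ : _ - _ = 5 / 9 * e ^+ 2); last by field.
by rewrite mulr_gt0 ?exprn_gt0// divr_gt0.
Qed.

HB.instance Definition _ := Uniform_isComplete.Build l2 (complete_of_seq l2_seq_complete).

Lemma l2_hdotE u : l2dot u u = `|u| ^+ 2.
Proof. by rewrite -(dot_norm_sqr l2dot). Qed.

Definition l2_hilbert : hilbertSpace R := HilbertSpace (hilbert_sort := l2) l2_hdotE.

End L2.

Section ComplexHilbert.
Variable R : realType.
Local Notation C := R[i].

(** The complex line as a one-dimensional space over itself. It is a constant
    of its own because the completeness attached to [_^o] is that of the real
    line. *)
Definition cline : Type := C^o.
HB.instance Definition _ := NormedModule.copy cline C^o.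

Lemma rnorm_complex (z : cline) : rnorm z = cnorm z.
Proof. by apply: (@complexI R); rewrite -rnormE cnormE. Qed.

Lemma complex_seq_complete (u : nat -> cline) : seq_cauchy u -> exists l, seq_lim u l.
Proof.
(* the real line is complete in its own norm, hence along real sequences *)
have real_complete (v : nat -> R) :
    (forall e, 0 < e -> exists N, forall m n, (N <= m)%N -> (N <= n)%N -> `|v m - v n| < e) ->
    exists l, forall e, 0 < e -> exists N, forall n, (N <= n)%N -> `|v n - l| < e.
  move=> cv; have /cvg_ex[l vl] : cvg (v @ \oo).
    apply: cauchy_cvg; apply/cauchy_ballP => e e0.
    have [N HN] := cv e e0.
    exists ([set x | exists2 m, (N <= m)%N & x = v m],
            [set x | exists2 m, (N <= m)%N & x = v m]).
      by split; exists N => // n Nn; exists n.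
    by case=> x y [[m Nm /= ->] [n Nn /= ->]]; rewrite -ball_normE /=; exact: HN.
  exists l => e e0; have /cvgrPdist_lt/(_ _ e0)[N _ HN] := vl.
  by exists N => n Nn; rewrite distrC; exact: HN.
move=> cu.
have [e e0|x ux] := real_complete (fun n => complex.Re (u n)).
  have [N HN] := cu e e0; exists N => m n Nm Nn; rewrite -ReB.
  by rewrite (le_lt_trans (Re_norm_le_cnorm _))// -rnorm_complex HN.
have [e e0|y uy] := real_complete (fun n => complex.Im (u n)).
  have [N HN] := cu e e0; exists N => m n Nm Nn; rewrite -ImB.
  by rewrite (le_lt_trans (Im_norm_le_cnorm _))// -rnorm_complex HN.
exists (Complex x y) => e e0; have e2 : 0 < e / 2 by rewrite divr_gt0.
have [N HN] := ux _ e2; have [M HM] := uy _ e2.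
exists (maxn N M) => n; rewrite geq_max => /andP[Nn Mn].
rewrite rnorm_complex (le_lt_trans (cnorm_le_ReIm _))// ReB ImB /= [e]splitr.
by rewrite ltrD ?HN ?HM.
Qed.

HB.instance Definition _ :=
  Uniform_isComplete.Build cline (complete_of_seq complex_seq_complete).

Definition cdot (z w : cline) : C := z * Num.conj (w : C).

Lemma cdot_linear w : linear_for *%R (fun z => cdot z w).
Proof. by move=> a z z'; rewrite /cdot mulrDl -mulrA. Qed.

Lemma cdot_linearr z : linear_for (Num.conj \; *%R) (cdot z).
Proof. by move=> a w w'; rewrite /cdot rmorphD rmorphM /= mulrDr mulrCA. Qed.

HB.instance Definition _ := @bilinear_isBilinear.Build C cline cline C *%R (Num.conj \; *%R)
  cdot (cdot_linear, cdot_linearr).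

Lemma cdot_hermitian z w : cdot z w = (-1) ^+ false * Num.conj (cdot w z).
Proof. by rewrite expr0 mul1r /cdot rmorphM /= conjCK mulrC. Qed.

HB.instance Definition _ := @isHermitianSesquilinear.Build C cline false (@Num.conj C)
  cdot cdot_hermitian.

Lemma cdotE z : cdot z z = `|z| ^+ 2.
Proof. by rewrite /cdot -normCK. Qed.

Lemma cdot_gt0 (z : cline) : z != 0 -> 0 < cdot z z.
Proof. by move=> z0; rewrite cdotE exprn_gt0 ?normr_gt0. Qed.

HB.instance Definition _ := @isDotProduct.Build C cline cdot cdot_gt0.

Definition complex_hilbert : hilbertSpace R := HilbertSpace (hilbert_sort := cline) cdotE.

End ComplexHilbert.

Section SplitSums.
Variables (R : realType) (T : choiceType).
Implicit Types (g h : T -> R) (X : {fset T}).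

Lemma psum_split g X : (forall t, 0 <= g t) -> psummable g ->
  psum g = \sum_(t <- X) g t + psum (fun t => if t \in X then 0 else g t).
Proof.
move=> g0 gs.
have in0 t : 0 <= (if t \in X then g t else 0) by case: ifP.
have [|s1 e1] := psum_supp in0 (X := X); first by move=> t /negbTE ->.
have out0 t : 0 <= (if t \in X then 0 else g t) by case: ifP.
have s2 : psummable (fun t => if t \in X then 0 else g t).
  by apply: psummable_le gs => t; case: ifP.
have := psumD in0 out0 s1 s2; rewrite e1.
rewrite (eq_big_seq g) => [<-|t tX]; last by rewrite tX.
by congr psum; apply/funext => t; case: ifP; rewrite ?addr0 ?add0r.
Qed.

(** Meant for a rotation of finitely many coordinates, which changes the summands
    there without changing their sum. *)
Lemma psum_change g h X : (forall t, 0 <= g t) -> (forall t, 0 <= h t) ->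
  (forall t, t \notin X -> g t = h t) -> \sum_(t <- X) g t = \sum_(t <- X) h t ->
  psummable h -> psummable g /\ psum g = psum h.
Proof.
move=> g0 h0 gh sgh hs.
have gs : psummable g.
  have in0 t : 0 <= (if t \in X then g t else 0) by case: ifP.
  have [|s1 _] := psum_supp in0 (X := X); first by move=> t /negbTE ->.
  apply: psummable_le (psummableD in0 h0 s1 hs) => t.
  by case: ifPn => [_|/gh ->]; rewrite ?add0r ?lerDl.
split=> //; rewrite (psum_split X g0 gs) (psum_split X h0 hs) sgh; congr (_ + psum _).
by apply/funext => t; case: ifPn => // /gh.
Qed.

Lemma psum_approx g (e : R) : (forall t, 0 <= g t) -> psummable g -> 0 < e ->
  exists X : {fset T}, psum g - e < \sum_(t <- X) g t.
Proof.
move=> g0 gs e0; apply: contrapT => H.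
have [|_] := @psum_le_fset _ _ g (psum g - e) g0; last by rewrite leNgt ltrBlDr ltrDl e0.
by move=> X; rewrite leNgt; apply/negP => ?; apply: H; exists X.
Qed.

Lemma psum_reindex g (f f' : T -> T) : cancel f f' -> cancel f' f ->
  psum (g \o f) = psum g /\ (psummable g -> psummable (g \o f)).
Proof.
move=> ff' f'f; have bf : set_bij [set: T] [set: T] f.
  by split=> [//|x y _ _ /(can_inj ff')//|y _]; exists (f' y).
have e : (\esum_(t in [set: T]) (g t)%:E = \esum_(t in [set: T]) (g (f t))%:E)%E.
  exact: reindex_esum bf.
by rewrite /psum /psummable e.
Qed.

End SplitSums.

(** Used for the closure of [S]: membership composes with linear operations by
    estimates in the real-valued norm alone. *)
Definition adherent (R : realType) (V : normedModType R[i]) (S : set V) : set V :=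
  [set x | forall e : R, 0 < e -> exists2 y, S y & rnorm (x - y) < e].

Section Adherent.
Variables (R : realType) (V : normedModType R[i]) (S : set V).
Local Notation C := R[i].

Lemma adherent_sub x : S x -> adherent S x.
Proof. by move=> Sx e e0; exists x; rewrite ?subrr ?rnorm0. Qed.

Lemma adherent_adherent x : adherent (adherent S) x -> adherent S x.
Proof.
move=> ax e e0; have e2 : 0 < e / 2 by rewrite divr_gt0.
have [y ay xy] := ax _ e2; have [z Sz yz] := ay _ e2; exists z => //.
by rewrite (le_lt_trans (rnormB_trans _ y _))// [e]splitr ltrD.
Qed.

Hypothesis SP : forall (a : C) x y, S x -> S y -> S (a *: x + y).

Lemma adherentP (a : C) x y : adherent S x -> adherent S y -> adherent S (a *: x + y).
Proof.
move=> ax ay e e0; pose k := cnorm a + 1.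
have k0 : 0 < k by rewrite ltr_wpDl ?cnorm_ge0.
have [x' Sx' xx'] := ax (e / 2 / k) (divr_gt0 (divr_gt0 e0 (ltr0n _ 2)) k0).
have [y' Sy' yy'] := ay _ (divr_gt0 e0 (ltr0n _ 2)).
exists (a *: x' + y'); first exact: SP.
rewrite opprD addrACA -scalerBr (le_lt_trans (rnormD _ _))// [e]splitr ltr_leD ?(ltW yy')//.
rewrite rnormZ; apply: le_lt_trans (_ : k * rnorm (x - x') < _).
  by rewrite ler_wpM2r ?rnorm_ge0// lerDl.
by rewrite mulrC -ltr_pdivlMr.
Qed.

Lemma adherent_sum (I : Type) (r : seq I) (F : I -> V) : adherent S 0 ->
  (forall i, adherent S (F i)) -> adherent S (\sum_(i <- r) F i).
Proof.
move=> S0 SF; elim: r => [|i r IH]; first by rewrite big_nil.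
by rewrite big_cons -[F i]scale1r; exact: adherentP.
Qed.

End Adherent.

Section Single.
Variables (R : realType) (T : choiceType) (H : hilbertSpace R).
Local Notation C := R[i].
Implicit Types (t s : T) (x y : H) (u v : l2 T H).

Lemma single_l2 t x : (fun s => if s == t then x else 0) \in @l2fun R T H.
Proof.
apply/l2funP; have [||//] := @psum_supp _ _ (fun s => rnorm (if s == t then x else 0) ^+ 2)
  [fset t]%fset.
- by move=> s; rewrite exprn_ge0 ?rnorm_ge0.
- by move=> s; rewrite inE => /negbTE ->; rewrite rnorm0 expr0n.
Qed.

Definition single t x : l2 T H := MkL2 (single_l2 t x).

Lemma singleE t x s : l2val (single t x) s = if s == t then x else 0.
Proof. by []. Qed.

Lemma single_linear t : linear (single t).
Proof.
move=> a x y; apply: l2_ext => s; rewrite l2D l2Z !singleE.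
by case: ifP; rewrite ?scaler0 ?addr0.
Qed.
HB.instance Definition _ t := GRing.isLinear.Build C H (l2 T H) _ (single t) (single_linear t).

Lemma dot_single t x v : hdot (l2_hilbert T H) (single t x) v = hdot H x (l2val v t).
Proof.
rewrite [LHS]/= /l2dot (@csum1 _ _ _ t) => [|s /negbTE st]; rewrite singleE ?eqxx//.
by rewrite st dot0l.
Qed.

Lemma rnorm_single t x : rnorm (single t x) = rnorm x.
Proof.
apply: (@eq_rnorm_sqn _ (l2_hilbert T H)).
by rewrite dot_single singleE eqxx.
Qed.

(** A square-summable function is close to its restrictions to large finite
    sets, and these are sums of functions supported at one point. *)
Lemma dense_l2 (H0 : set H) (S : set (l2 T H)) :
  dense H0 -> (forall (a : C) u v, S u -> S v -> S (a *: u + v)) -> S 0 ->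
  (forall t x, H0 x -> S (single t x)) -> dense S.
Proof.
move=> dH SP S0 SH; apply/dense_rnorm.
have Ssingle t x : adherent S (single t x).
  move=> e e0; have /dense_rnorm/(_ x e e0)[y Hy xy] := dH.
  exists (single t y); first exact: SH.
  by rewrite -linearB rnorm_single.
move=> u; apply: (adherent_adherent) => e e0.
have u0 t : 0 <= rnorm (l2val u t) ^+ 2 by rewrite exprn_ge0 ?rnorm_ge0.
have [X HX] := psum_approx u0 (l2_summable u) (exprn_gt0 2 e0).
exists (\sum_(t <- X) single t (l2val u t)).
  by apply: (adherent_sum SP) => //; exact: adherent_sub.
rewrite -ltr_sqr ?nnegrE ?rnorm_ge0 ?ltW// l2_rnorm_sqr.
have -> : (fun t => rnorm (l2val (u - \sum_(t <- X) single t (l2val u t)) t) ^+ 2) =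
          (fun t => if t \in X then 0 else rnorm (l2val u t) ^+ 2).
  apply/funext => t; rewrite l2B.
  have -> : l2val (\sum_(s <- X) single s (l2val u s)) t = if t \in X then l2val u t else 0.
    have -> (r : seq T) (F : T -> l2 T H) :
        l2val (\sum_(s <- r) F s) t = \sum_(s <- r) l2val (F s) t.
      elim: r => [|s r IH]; first by rewrite !big_nil.
      by rewrite !big_cons l2D IH.
    under eq_bigr do rewrite singleE eq_sym.
    case: ifPn => tX.
      rewrite (bigD1_seq t) ?fset_uniq//= eqxx big1 ?addr0// => s /negbTE st.
      by rewrite st.
    rewrite big_seq big1// => s sX; case: eqP => // st.
    by rewrite -st sX in tX.
  by case: ifP; rewrite ?subrr ?subr0 ?rnorm0 ?expr0n.
by have := psum_split X u0 (l2_summable u); lra.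
Qed.

End Single.

(** * Representations of a free group from operators for its letters *)

Section Isometries.
Variables (R : realType) (H K : hilbertSpace R) (T : {linear H -> K}).
Local Notation C := R[i].

(** Polarization: the real part of the inner product is determined by the norm,
    and the imaginary part is the real part against ['i *: y]. *)
Lemma isometry_dot : (forall x, rnorm (T x) = rnorm x) ->
  forall x y, hdot K (T x) (T y) = hdot H x y.
Proof.
move=> Tn; have reE x y : complex.Re (hdot K (T x) (T y)) = complex.Re (hdot H x y).
  have sq (L : hilbertSpace R) (u v : L) : rnorm (u + v) ^+ 2 =
      rnorm u ^+ 2 + complex.Re (hdot L u v) *+ 2 + rnorm v ^+ 2.
    rewrite -!sqn_hdot /sqn dotDl !dotDr (dotC _ v u) !ReD Re_conj; ring.
  have := sq _ (T x) (T y); rewrite -linearD !Tn sq; lra.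
move=> x y; apply: complexP; first exact: reE.
have := reE x ((Complex 0 1) *: y); rewrite linearZ !dotZr !ReM /=; lra.
Qed.

End Isometries.

Section FreeGroupRepresentation.
Variables (R : realType) (d : nat) (K : hilbertSpace R) (A : letter d -> {linear K -> K}).
Hypothesis AK : forall a x, A (inv_letter a) (A a x) = x.
Hypothesis A_iso : forall a x, rnorm (A a x) = rnorm x.

Definition word_op (w : seq (letter d)) (x : K) : K := foldr (fun a y => A a y) x w.

Lemma word_op_linear w : linear (word_op w).
Proof. by move=> a x y; elim: w => //= b w ->; rewrite linearP. Qed.
HB.instance Definition _ w := GRing.isLinear.Build R[i] K K _ (word_op w) (word_op_linear w).

Lemma word_op_push a w x : word_op (push a w) x = A a (word_op w x).
Proof.
case: w => //= b w; case: eqP => // ->.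
by have := AK (inv_letter a) (word_op w x); rewrite inv_letterK => ->.
Qed.

Lemma word_op_concat u w x : word_op (concat u w) x = word_op u (word_op w x).
Proof. by elim: u => //= a u IH; rewrite word_op_push IH. Qed.

Lemma word_op_iso w x : rnorm (word_op w x) = rnorm x.
Proof. by elim: w => //= a w IH; rewrite A_iso. Qed.

(** Freeness: invertible operators for the letters extend to a representation,
    because cancelling adjacent inverse letters does not change the product. *)
Definition free_rep : @unitary_rep R (free_group d) K.
Proof.
refine (@UnitaryRep R (free_group d) K (fun s => word_op (fg_word s)) _ _ _).
- by [].
- by move=> s t x; exact: word_op_concat.
- by move=> s x y; apply: isometry_dot => z; exact: word_op_iso.
Defined.

Lemma free_repE s x : free_rep s x = word_op (fg_word s) x.
Proof. by []. Qed.

End FreeGroupRepresentation.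

Section RepBasics.
Variables (R : realType) (G : groupType) (H : hilbertSpace R) (pi : @unitary_rep R G H).

Lemma repK s x : pi s^-1%g (pi s x) = x.
Proof. by rewrite -repM mulVg rep1. Qed.
Lemma repVK s x : pi s (pi s^-1%g x) = x.
Proof. by rewrite -repM mulgV rep1. Qed.
Lemma rep_norm s x : rnorm (pi s x) = rnorm x.
Proof. by apply: eq_rnorm_sqn; rewrite rep_unitary. Qed.
Lemma rep_adj s x y : hdot H (pi s x) y = hdot H x (pi s^-1%g y).
Proof. by rewrite -{1}[y](repVK s) rep_unitary. Qed.

End RepBasics.

(** * The deformation of a representation *)

(** The translation by [g], tensored with [pi g], followed by the rotation with
    cosine [c] and sine [a] in the plane of the coordinates [1] and [g]. Translation
    alone moves the vacuum, the function supported at [1], off itself completely;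
    the rotation leaves the fraction [a] of it behind. *)
Section TwistedTranslation.
Variables (R : realType) (G : groupType) (H : hilbertSpace R) (pi : @unitary_rep R G H).
Variables (a c : R).
Hypothesis ac1 : a ^+ 2 + c ^+ 2 = 1.
Local Notation C := R[i].
Local Notation "x %:C" := (real_complex R x).

Definition twist_fun (g : G) (u : G -> H) : G -> H := fun t =>
  pi g (if t == 1%g then a%:C *: u 1%g + c%:C *: u g^-1%g
        else if t == g then c%:C *: u 1%g - a%:C *: u g^-1%g
        else u (g^-1 * t)%g).

(** Off [1] and [g] the operator is a translation; on these two coordinates it is
    a rotation, which preserves the sum of the squared norms. *)
Lemma twist_norm g u : g != 1%g -> psummable (fun t => rnorm (u t) ^+ 2) ->
  psummable (fun t => rnorm (twist_fun g u t) ^+ 2) /\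
  psum (fun t => rnorm (twist_fun g u t) ^+ 2) = psum (fun t => rnorm (u t) ^+ 2).
Proof.
move=> g1 su.
have [e shs] := psum_reindex (fun t => rnorm (u t) ^+ 2) (mulVKg g) (mulKg g).
rewrite -e; apply: (@psum_change _ _ _ _ [fset 1%g; g]%fset).
- by move=> t; exact: rnorm_sqr_ge0.
- by move=> t; exact: rnorm_sqr_ge0.
- move=> t; rewrite !inE negb_or => /andP[/negbTE t1 /negbTE tg].
  by rewrite /twist_fun t1 tg rep_norm.
- rewrite !big_fsetU1 ?inE 1?eq_sym//= !big_seq_fset1 /twist_fun eqxx (negbTE g1) eqxx.
  rewrite !rep_norm mulg1 mulVg -!sqn_hdot.
  set x := u 1%g; set y := u g^-1%g.
  have cc (r : R) : Num.conj (r%:C) = r%:C by rewrite conjCE conjc_real.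
  apply: (@complexI R); rewrite !rmorphD /= -!sqnE.
  rewrite !(dotDl, dotDr, dotNl, dotNr, dotZl, dotZr) !cc.
  have ac : a%:C ^+ 2 + c%:C ^+ 2 = 1 by rewrite -!rmorphXn -rmorphD ac1.
  transitivity ((a%:C ^+ 2 + c%:C ^+ 2) * (hdot H y y + hdot H x x)); first by ring.
  by rewrite ac mul1r.
- exact: shs.
Qed.

Definition twist_l2 (g : G) (g1 : g != 1%g) (u : l2 G H) : l2 G H :=
  @MkL2 _ _ _ (twist_fun g (l2val u))
    (introT (l2funP _) (twist_norm g1 (l2_summable u)).1).

Lemma twist_l2_linear g (g1 : g != 1%g) : linear (twist_l2 g1).
Proof.
move=> b u v; apply: l2_ext => t; rewrite l2D l2Z.
change (twist_fun g (l2val (b *: u + v)) t =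
  b *: twist_fun g (l2val u) t + twist_fun g (l2val v) t).
rewrite /twist_fun -linearP; congr (pi g _); case: ifP => _; [|case: ifP => _].
- rewrite !l2D !l2Z !scalerDr !scalerA addrACA.
  by rewrite [b * a%:C]mulrC [b * c%:C]mulrC.
- rewrite !l2D !l2Z !scalerDr !scalerN !scalerA opprD addrACA.
  by rewrite [b * a%:C]mulrC [b * c%:C]mulrC.
- by rewrite l2D l2Z.
Qed.
HB.instance Definition _ g (g1 : g != 1%g) :=
  GRing.isLinear.Build C (l2 G H) (l2 G H) _ (twist_l2 g1) (twist_l2_linear g1).

Lemma twist_l2_iso g (g1 : g != 1%g) u : rnorm (twist_l2 g1 u) = rnorm u.
Proof.
apply/eqP; rewrite -(eqrXn2 (n:=2))// ?rnorm_ge0// !l2_rnorm_sqr; apply/eqP.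
exact: (twist_norm g1 (l2_summable u)).2.
Qed.

Lemma twist_l2K g (g1 : g != 1%g) (g1' : g^-1%g != 1%g) u :
  twist_l2 g1' (twist_l2 g1 u) = u.
Proof.
have ac : a%:C * a%:C + c%:C * c%:C = 1 by rewrite -!expr2 -!rmorphXn -rmorphD ac1.
apply: l2_ext => t; rewrite /= /twist_fun invgK eqxx eqxx (negbTE g1).
have [->|t1] := eqVneq t 1%g.
  rewrite -!linearZ -linearD repK !scalerDr !scalerN !scalerA.
  rewrite addrACA -scalerDl ac scale1r -scalerBl.
  by rewrite mulrC subrr scale0r addr0.
have [->|tg] := eqVneq t g^-1%g.
  rewrite -!linearZ -linearB repK !scalerDr !scalerN !scalerA opprD opprK.
  rewrite addrACA [c%:C * a%:C]mulrC subrr add0r.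
  by rewrite -scalerDl addrC ac scale1r.
have -> : (g * t == 1)%g = false.
  by apply: contraNF tg => /eqP gt1; rewrite -[t](mulKg g) gt1 mulg1.
have -> : (g * t == g)%g = false.
  by apply: contraNF t1 => /eqP gt1; rewrite -[t](mulKg g) gt1 mulVg.
by rewrite mulKg repK.
Qed.

(** The translation sends the vacuum to the coordinate [g], which the rotation
    then mixes with [1]. *)
Lemma twist_single1 g (g1 : g != 1%g) x : twist_l2 g1 (single 1%g x) =
  single g (c%:C *: pi g x) + single 1%g (a%:C *: pi g x).
Proof.
have gV1 : (g^-1 == 1)%g = false by rewrite invg_eq1; exact: negbTE.
apply: l2_ext => t; rewrite l2D !singleE /= /twist_fun eqxx gV1 !scaler0 addr0 subr0.
have [->|t1] := eqVneq t 1%g; first by rewrite eq_sym (negbTE g1) add0r linearZ.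
have [_|tg] := eqVneq t g; first by rewrite addr0 linearZ.
case: eqP => [gt|_]; last by rewrite addr0 linear0.
by case/eqP: tg; rewrite -[t](mulVKg g) gt mulg1.
Qed.

Lemma twist_single g (g1 : g != 1%g) t x : t != 1%g -> (g * t)%g != 1%g ->
  twist_l2 g1 (single t x) = single (g * t)%g (pi g x).
Proof.
move=> t1 gt1; have gVt : (g^-1 == t)%g = false.
  by apply: contraNF gt1 => /eqP <-; rewrite mulgV.
have t1' : (1 == t)%g = false by rewrite eq_sym (negbTE t1).
apply: l2_ext => s; rewrite !singleE /= /twist_fun t1' gVt !scaler0 addr0 subr0.
have [->|s1] := eqVneq s 1%g.
  by rewrite eq_sym (negbTE gt1); exact: linear0.
have [->|sg] := eqVneq s g.
  have -> : (g == g * t)%g = false by rewrite -{1}[g]mulg1 (inj_eq (mulgI g)).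
  exact: linear0.
by rewrite -(inj_eq (mulgI g)) mulVKg; case: ifP => _; rewrite ?linear0.
Qed.

End TwistedTranslation.

Section Words.
Variable d : nat.
Local Notation G := (free_group d).
Implicit Types (s t : G) (x : letter d) (w : seq (letter d)).

Definition gen x : G := @FreeGroup d [:: x] isT.

Lemma gen_neq1 x : gen x != 1%g.
Proof. by rewrite -(inj_eq val_inj). Qed.

Lemma genV x : gen (inv_letter x) = (gen x)^-1%g.
Proof. exact: val_inj. Qed.

Lemma fg_wordM s t : fg_word (s * t)%g = concat (fg_word s) (fg_word t).
Proof. by []. Qed.

Definition wlen s : nat := size (fg_word s).

Lemma wlenV s : wlen s^-1%g = wlen s.
Proof. by rewrite /wlen size_rev size_map. Qed.

Lemma wlenM s t : (wlen (s * t)%g <= wlen s + wlen t)%N.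
Proof.
rewrite /wlen fg_wordM; elim: (fg_word s) => //= x w IH; rewrite addSn.
apply: leq_trans (_ : (size (concat w (fg_word t))).+1 <= _)%N; last by [].
by case: (concat w _) => //= y v; case: eqP => //= _; rewrite ltnW.
Qed.

Lemma push_cons x w : reduced (x :: w) -> push x w = x :: w.
Proof. by case: w => //= y w /andP[/negbTE ->]. Qed.

Lemma genM x s t : fg_word t = x :: fg_word s -> t = (gen x * s)%g.
Proof.
move=> ts; apply: val_inj; rewrite [LHS]ts /= push_cons//.
by rewrite -ts; exact: fg_reduced.
Qed.

Lemma free_group_rect_l (P : G -> Prop) : P 1%g ->
  (forall x s t, fg_word t = x :: fg_word s -> P s -> P t) -> forall s, P s.
Proof.
move=> P1 PS [w w_red]; elim: w w_red => [|x w IH] w_red.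
  by rewrite (_ : FreeGroup _ = 1%g)//; exact: val_inj.
have w_red' : reduced w by exact: path_sorted w_red.
exact: (PS x (FreeGroup w_red') (FreeGroup w_red) erefl (IH w_red')).
Qed.

Lemma free_group_rect_r (P : G -> Prop) : P 1%g ->
  (forall x s t, fg_word t = rcons (fg_word s) x -> P s -> P t) -> forall s, P s.
Proof.
move=> P1 PS s; rewrite -[s]invgK; elim/free_group_rect_l: (s^-1)%g => [|x {}s t ts Ps].
  by rewrite invg1.
apply: (PS (inv_letter x) s^-1%g) => //.
by rewrite /= /inv_word ts /= rev_cons.
Qed.

Lemma rconsM x s t : fg_word t = rcons (fg_word s) x -> t = (s * gen x)%g.
Proof.
move=> ts; apply: invg_inj; rewrite invgM -genV; apply: genM.
by rewrite /= /inv_word ts map_rcons rev_rcons.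
Qed.

End Words.

(** Up to equivalence this is the tensor product of [pi] with a representation
    of which the positive definite function [a ^+ wlen s] is a coefficient. The
    realisation on square-summable functions makes the space complete and the
    deformed operators explicit. *)
Section Deformation.
Variables (R : realType) (d : nat) (H : hilbertSpace R).
Variable pi : @unitary_rep R (free_group d) H.
Variables (a c : R).
Hypothesis ac1 : a ^+ 2 + c ^+ 2 = 1.
Local Notation C := R[i].
Local Notation G := (free_group d).
Local Notation K := (l2_hilbert G H).
Local Notation "x %:C" := (real_complex R x).

Definition letter_op (x : letter d) : {linear K -> K} := twist_l2 pi ac1 (gen_neq1 x).

Lemma letter_opK x u : letter_op (inv_letter x) (letter_op x u) = u.
Proof.
rewrite /letter_op; move: (gen_neq1 (inv_letter x)); rewrite genV => g1.
exact: twist_l2K.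
Qed.

Lemma letter_op_iso x u : rnorm (letter_op x u) = rnorm u.
Proof. exact: twist_l2_iso. Qed.

Definition deform : @unitary_rep R G K := free_rep letter_opK letter_op_iso.

Lemma deform_cons x s t u : fg_word t = x :: fg_word s ->
  deform t u = letter_op x (deform s u).
Proof. by move=> ts; rewrite !free_repE ts. Qed.

Lemma deform_rcons x s t u : fg_word t = rcons (fg_word s) x ->
  deform t u = deform s (letter_op x u).
Proof. by move=> ts; rewrite !free_repE ts /word_op foldr_rcons. Qed.

(** Away from cancellations the twisted translations are the plain ones. *)
Lemma deform_single s r t xi : r != 1%g -> fg_word t = fg_word s ++ fg_word r ->
  deform s (single r xi) = single t (pi s xi).
Proof.
move=> r1; elim/free_group_rect_l: s t => [t tr|x s s' s's IH t ts'].
  by rewrite !rep1; congr single; apply: val_inj.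
have t_red : reduced (x :: fg_word s ++ fg_word r).
  by have := fg_reduced t; rewrite ts' s's.
have t0_red : reduced (fg_word s ++ fg_word r) by exact: path_sorted t_red.
pose t0 : G := FreeGroup t0_red.
rewrite (deform_cons _ s's) (IH t0 erefl).
have tt0 : t = (gen x * t0)%g by apply: genM; rewrite ts' s's.
rewrite [LHS]/= twist_single -?tt0.
- by rewrite -repM -(genM s's).
- apply: contra_neq r1 => /(congr1 (@fg_word d)) /=.
  by case E : (fg_word s) => //= r1; apply: val_inj.
- by apply/eqP => /(congr1 (@fg_word d)); rewrite ts' s's.
Qed.

(** The last letter of a reduced word is the first to act on the vacuum. The
    component carried off to that letter never meets a cancellation again, and
    the component left behind is treated by the rest of the word, with one more
    factor [a]. *)
Lemma deform_step x s t xi : fg_word t = rcons (fg_word s) x ->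
  deform t (single 1%g xi) =
  single t (c%:C *: pi t xi) + a%:C *: deform s (single 1%g (pi (gen x) xi)).
Proof.
move=> ts; rewrite (deform_rcons _ ts) [letter_op _ _]twist_single1 linearD.
rewrite (@deform_single s (gen x) t) ?gen_neq1//; last by rewrite ts -cats1.
by rewrite !linearZ /= -repM -(rconsM ts).
Qed.

Lemma deform_vacuum s xi : l2val (deform s (single 1%g xi)) 1%g = (a ^+ wlen s)%:C *: pi s xi.
Proof.
elim/free_group_rect_r: s xi => [|x s t ts IH] xi.
  by rewrite !rep1 singleE eqxx expr0 scale1r.
rewrite (deform_step _ ts) l2D l2Z IH singleE.
have -> : (1 == t)%g = false.
  by apply/eqP => /(congr1 (@fg_word d)); rewrite ts /=; case: (fg_word s).
rewrite add0r scalerA -repM -(rconsM ts) /wlen ts size_rcons exprS.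
by rewrite rmorphM.
Qed.

(** These play the role of elementary tensors: a deformed vacuum vector in the
    first factor and [xi] in the second. The twist by [pi s^-1] undoes the action
    on the second factor. *)
Definition orbit_vector s xi : K := deform s (single 1%g (pi s^-1%g xi)).

Lemma orbit_vectorP s b xi eta :
  orbit_vector s (b *: xi + eta) = b *: orbit_vector s xi + orbit_vector s eta.
Proof. by rewrite /orbit_vector !linearP. Qed.

Lemma coef_orbit s t xi eta r :
  coef deform (orbit_vector s xi) (orbit_vector t eta) r =
  (a ^+ wlen (t^-1 * r * s)%g)%:C * coef pi xi eta r.
Proof.
rewrite /coef /orbit_vector -repM -[X in hdot K _ X]/(deform t _).
rewrite -{1}[t]invgK -rep_adj -repM mulgA.
rewrite dotC dot_single deform_vacuum -dotC dotZl; congr (_ * _).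
by rewrite -repM mulgK repM rep_unitary.
Qed.

Variable H0 : set H.
Hypothesis H00 : H0 0.
Hypothesis H0P : forall (b : C) x y, H0 x -> H0 y -> H0 (b *: x + y).

Inductive orbit_span : set K :=
| orbit_span0 : orbit_span 0
| orbit_spanS s xi u : H0 xi -> orbit_span u -> orbit_span (orbit_vector s xi + u).

Lemma orbit_spanP (b : C) u v : orbit_span u -> orbit_span v -> orbit_span (b *: u + v).
Proof.
move=> su sv; elim: su => [|s xi u' Hxi _ IH]; first by rewrite scaler0 add0r.
rewrite scalerDr -addrA -[b *: _](_ : orbit_vector s (b *: xi) = _).
  by apply: orbit_spanS => //; rewrite -[_ *: _]addr0; exact: H0P.
by rewrite -[b *: xi]addr0 orbit_vectorP /orbit_vector !linear0 addr0.
Qed.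

(** By [deform_step] the function supported at [s] is a combination of the orbit
    vectors of [s] and of its prefix with one letter less. *)
Lemma orbit_span_single s xi : c != 0 -> H0 xi -> orbit_span (single s xi).
Proof.
move=> c0 Hxi; have sv t : orbit_span (orbit_vector t xi).
  by rewrite -[orbit_vector _ _]addr0; apply: orbit_spanS => //; exact: orbit_span0.
elim/free_group_rect_r: s => [|x s t ts _].
  by have := sv 1%g; rewrite /orbit_vector invg1 !rep1.
have := deform_step (pi t^-1%g xi) ts.
rewrite repVK -repM (_ : gen x * t^-1 = s^-1)%g; last first.
  by rewrite (rconsM ts) invgM mulgA mulgV mul1g.
rewrite -!/(orbit_vector _ _) => e.
have -> : single t xi = c%:C^-1 *: (- a%:C *: orbit_vector s xi + orbit_vector t xi) + 0.
  rewrite e addr0 scaleNr addrCA addNr addr0 linearZ scalerA.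
  by rewrite mulVf ?scale1r// (inj_eq (@complexI R) c 0).
by do 2?apply: orbit_spanP => //; exact: orbit_span0.
Qed.

(** Coefficients are sesquilinear in the two vectors, so it suffices to look at
    the orbit vectors, whose span is dense. *)
Lemma deform_D_representation (D : set (G -> C)) : c != 0 -> dense H0 ->
  D (fun=> 0) -> (forall f g, D f -> D g -> D (fun r => f r + g r)) ->
  (forall s t xi eta, H0 xi -> H0 eta ->
     D (fun r => (a ^+ wlen (t^-1 * r * s)%g)%:C * coef pi xi eta r)) ->
  D_representation D deform.
Proof.
move=> c0 dH D0 DD HD; exists orbit_span; split.
- exact: orbit_span0.
- exact: orbit_spanP.
- apply: (dense_l2 dH orbit_spanP orbit_span0) => s xi; exact: orbit_span_single.
- move=> u v su sv; elim: su => [|s xi u' Hxi _ IHu].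
    by rewrite (_ : coef _ _ _ = fun=> 0)//; apply/funext => r; rewrite /coef linear0 dot0l.
  rewrite (_ : coef _ _ _ = fun r => coef deform (orbit_vector s xi) v r + coef deform u' v r).
    apply: (DD) => // {u' IHu}; elim: sv => [|t eta v' Heta _ IHv].
      by rewrite (_ : coef _ _ _ = fun=> 0)//; apply/funext => r; rewrite /coef dot0r.
    rewrite (_ : coef _ _ _ = fun r =>
        (a ^+ wlen (t^-1 * r * s)%g)%:C * coef pi xi eta r +
        coef deform (orbit_vector s xi) v' r); first by apply: DD => //; exact: HD.
    by apply/funext => r; rewrite -coef_orbit /coef dotDr.
  by apply/funext => r; rewrite /coef linearD dotDl.
Qed.

End Deformation.

(** * Decay of the coefficients *)

Section EllSpaces.
Variables (R : realType) (G : groupType).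
Local Notation C := R[i].
Implicit Types (u v : G -> C) (p q r x y : R).

Lemma ellpP q u : ellp q%:E u <-> psummable (fun s => cnorm (u s) `^ q).
Proof.
rewrite /ellp /= /summable /psummable; under eq_esum do rewrite gee0_abs ?lee_fin ?powR_ge0//.
by [].
Qed.

Lemma ellp0 q : 0 < q -> ellp q%:E (fun _ : G => 0 : C).
Proof.
move=> q0; apply/ellpP; rewrite /psummable esum1 ?ltry// => s _.
by rewrite cnorm0 powR0 ?gt_eqF.
Qed.

Lemma ellp_dominated q (k : R) u v : 0 <= q -> 0 <= k ->
  (forall s, cnorm (v s) <= k * cnorm (u s)) -> ellp q%:E u -> ellp q%:E v.
Proof.
move=> q0 k0 vu /ellpP su; apply/ellpP.
apply: psummable_le (psumZ (fun s => powR_ge0 _ _) (powR_ge0 k q) su).1 => s.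
rewrite -powRM ?cnorm_ge0//; apply: ge0_ler_powR => //; rewrite nnegrE ?cnorm_ge0//.
by rewrite mulr_ge0 ?cnorm_ge0.
Qed.

Lemma ellpD q u v : 0 <= q -> ellp q%:E u -> ellp q%:E v ->
  ellp q%:E (fun s => u s + v s).
Proof.
move=> q0 /ellpP su /ellpP sv; apply/ellpP.
have pos (w : G -> C) s : 0 <= cnorm (w s) `^ q by exact: powR_ge0.
have suv := psummableD (pos u) (pos v) su sv.
apply: psummable_le (psumZ _ (powR_ge0 2 q) suv).1 => s; last by rewrite addr_ge0.
apply: (@le_trans _ _ ((2 * Num.max (cnorm (u s)) (cnorm (v s))) `^ q)).
  apply: ge0_ler_powR; rewrite ?nnegrE ?cnorm_ge0//.
    by rewrite mulr_ge0// le_max cnorm_ge0.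
  by rewrite (le_trans (cnormD _ _))// mulr_natl mulr2n lerD// le_max lexx ?orbT.
rewrite powRM ?le_max ?cnorm_ge0// ler_wpM2l ?powR_ge0//.
by rewrite /Num.max; case: ifP => _; rewrite ?lerDl ?lerDr powR_ge0.
Qed.

Lemma ellp_le p q u : 0 < p -> p <= q -> ellp p%:E u -> ellp q%:E u.
Proof.
move=> p0 pq /ellpP su; apply/ellpP; set B := psum (fun s => cnorm (u s) `^ p).
have pos s : 0 <= cnorm (u s) `^ p by exact: powR_ge0.
pose k := q / p - 1.
have k0 : 0 <= k by rewrite subr_ge0 ler_pdivlMr// mul1r.
apply: psummable_le (psumZ pos (powR_ge0 B k) su).1 => s.
have -> : q = p * (1 + k) by rewrite /k; field; rewrite gt_eqF.
rewrite powRrM powRD; last by rewrite gt_eqF// ltr_wpDr.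
rewrite powRr1// mulrC ler_wpM2r//; apply: ge0_ler_powR; rewrite ?nnegrE//.
- exact: psum_ge0.
- exact: (psum_ge1 s pos su).
Qed.

(** The pointwise inequality that stands in for Hoelder's: after writing [x] and
    [y] as powers of [x `^ q] and [y `^ r], both are bounded by the same powers
    of the larger of the two. *)
Lemma powR_mul_le q r p x y : 0 < q -> 0 < r -> 0 < p -> p^-1 = q^-1 + r^-1 ->
  0 <= x -> 0 <= y -> (x * y) `^ p <= x `^ q + y `^ r.
Proof.
move=> q0 r0 p0 pqr x0 y0; set M := Num.max (x `^ q) (y `^ r).
have M0 : 0 <= M by rewrite le_max powR_ge0.
apply: (@le_trans _ _ M); last first.
  by rewrite /M /Num.max; case: ifP => _; rewrite ?lerDl ?lerDr powR_ge0.
have xE : x `^ p = (x `^ q) `^ (p / q) by rewrite -powRrM mulrCA divff ?mulr1 ?gt_eqF.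
have yE : y `^ p = (y `^ r) `^ (p / r) by rewrite -powRrM mulrCA divff ?mulr1 ?gt_eqF.
have pp : p / q + p / r = 1 by rewrite -mulrDr -pqr divff ?gt_eqF.
rewrite powRM// xE yE -[leRHS]powRr1// -pp powRD ?pp ?oner_eq0//.
have pq0 : 0 <= p / q by rewrite divr_ge0// ltW.
have pr0 : 0 <= p / r by rewrite divr_ge0// ltW.
apply: ler_pM; rewrite ?powR_ge0//; apply: ge0_ler_powR;
  by rewrite ?nnegrE ?powR_ge0// /M le_max lexx ?orbT.
Qed.

Lemma ellp_mul q r p u v : 0 < q -> 0 < r -> 0 < p -> p^-1 = q^-1 + r^-1 ->
  ellp q%:E u -> ellp r%:E v -> ellp p%:E (fun s => u s * v s).
Proof.
move=> q0 r0 p0 pqr /ellpP su /ellpP sv; apply/ellpP.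
apply: psummable_le (psummableD _ _ su sv) => s; rewrite ?powR_ge0//.
by rewrite cnormM powR_mul_le ?cnorm_ge0.
Qed.

End EllSpaces.

Section WordSums.
Variables (R : realType) (d : nat).
Local Notation G := (free_group d).

Lemma count_words (X : {fset G}) n :
  (size [seq s <- X | wlen s == n] <= #|{: letter d}| ^ n)%N.
Proof.
rewrite -(size_map (@fg_word d)) -card_tuple cardE -[leqRHS](size_map val).
apply: uniq_leq_size.
  by rewrite map_inj_uniq ?filter_uniq ?fset_uniq//; exact: val_inj.
move=> w /mapP[s]; rewrite mem_filter => /andP[/eqP sn _] ->.
by apply/mapP; exists (Tuple (introT eqP sn)); rewrite ?mem_enum.
Qed.

Lemma geometric_le2 (b : R) n : 0 <= b -> b <= 2^-1 -> \sum_(i < n) b ^+ i <= 2.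
Proof.
move=> b0 b2; apply: (@le_trans _ _ (\sum_(i < n) (2^-1) ^+ i)).
  by apply: ler_sum => i _; apply: lerXn2r; rewrite ?nnegrE ?invr_ge0.
suff -> : \sum_(i < n) (2^-1 : R) ^+ i = 2 - 2 * 2^-1 ^+ n.
  by rewrite gerBl mulr_ge0 ?exprn_ge0.
elim: n => [|n IH]; first by rewrite big_ord0 expr0; lra.
by rewrite big_ord_recr /= IH exprS; lra.
Qed.

(** As there are at most [#|{: letter d}| ^ n] words of length [n], the sum is
    dominated by a geometric series of ratio at most one half. *)
Lemma psummable_wlen (b : R) : 0 <= b -> #|{: letter d}|%:R * b <= 2^-1 ->
  psummable (fun s : G => b ^+ wlen s).
Proof.
move=> b0 mb; have [|X|//] := @psum_le_fset _ _ (fun s : G => b ^+ wlen s) 2.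
  by move=> s; rewrite exprn_ge0.
pose N := (\max_(s <- X) wlen s).+1.
have wN s : s \in X -> (wlen s < N)%N.
  by move=> sX; rewrite ltnS; exact: (leq_bigmax_seq (F := @wlen d)).
have -> : \sum_(s <- X) b ^+ wlen s =
    \sum_(s <- X) \sum_(n < N) (if wlen s == n then b ^+ n else 0).
  apply: eq_big_seq => s /wN sN.
  rewrite (bigD1 (Ordinal sN))//= eqxx big1 ?addr0// => n /negbTE.
  by rewrite -val_eqE /= eq_sym => ->.
rewrite exchange_big /=; apply: le_trans (geometric_le2 N _ mb); last by rewrite mulr_ge0.
apply: ler_sum => n _; rewrite -big_mkcond -big_filter big_const_seq count_predT.
rewrite iter_addr addr0 exprMn -[leLHS]mulr_natl ler_wpM2r ?exprn_ge0//.
by rewrite -natrX ler_nat count_words.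
Qed.

(** For [a] close to [1] the function [a ^+ wlen _] need not be square-summable,
    but [a ^+ n] tends to [0], so that a large power of it satisfies the bound in
    [psummable_wlen]. *)
Lemma ellp_wlen (a B : R) : 0 < a -> a < 1 ->
  exists2 r, B <= r & ellp r%:E (fun s : G => ((a ^+ wlen s)%:C)%C).
Proof.
move=> a0 a1; pose e : R := (2 * (#|{: letter d}|%:R + 1))^-1.
have e0 : 0 < e by rewrite invr_gt0 mulr_gt0// ltr_wpDl.
have : a ^+ n @[n --> \oo] --> 0 by apply: cvg_expr; rewrite gtr0_norm.
move/cvgrPdist_lt => /(_ _ e0)[N _ HN].
pose n := maxn N (Num.bound `|B|).
exists n%:R.
  apply: le_trans (_ : (Num.bound `|B|)%:R <= _); last by rewrite ler_nat leq_maxr.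
  by rewrite (le_trans (ler_norm _))// ltW// archi_boundP.
have an : a ^+ n < e.
  by have := HN n (leq_maxl _ _); rewrite /= sub0r normrN ger0_norm// exprn_ge0 ?ltW.
apply/ellpP; apply: (@psummable_le _ _ _ (fun s => (a ^+ n) ^+ wlen s)) => [s|].
  rewrite cnorm_real ger0_norm ?exprn_ge0 ?(ltW a0)// powR_mulrn ?exprn_ge0 ?(ltW a0)//.
  by rewrite exprAC.
apply: psummable_wlen; first by rewrite exprn_ge0 ?(ltW a0).
apply: (@le_trans _ _ (#|{: letter d}|%:R * e)); first by rewrite ler_wpM2l// ltW.
by rewrite /e invfM mulrCA ler_piMr// ler_pdivrMr ?mul1r ?lerDl// ltr_wpDl.
Qed.

End WordSums.

(** * Comparison of the norms of two ideals *)

Section NormD.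
Variables (R : realType) (G : groupType).
Local Notation C := R[i].
Implicit Types (D : set (G -> C)).

Lemma le_norm_D D (H : hilbertSpace R) (pi : @unitary_rep R G H) f (x : H) :
  D_representation D pi -> rnorm x <= 1 -> ((rnorm (rep_alg pi f x))%:E <= norm_D D f)%E.
Proof.
move=> Dpi x1; apply: (@le_trans _ _ (opnorm (rep_alg pi f))).
  by apply: ereal_sup_ubound; exists x.
by apply: ereal_sup_ubound; exists H, pi.
Qed.

Lemma norm_D_le D f (M : \bar R) :
  (forall (H : hilbertSpace R) (pi : @unitary_rep R G H), D_representation D pi ->
     forall x, rnorm x <= 1 -> ((rnorm (rep_alg pi f x))%:E <= M)%E) ->
  (norm_D D f <= M)%E.
Proof.
move=> HM; apply: ge_ereal_sup => _ [H [pi [Dpi ->]]].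
by apply: ge_ereal_sup => _ [x x1 <-]; exact: HM.
Qed.

Lemma D_representation_sub D D' (H : hilbertSpace R) (pi : @unitary_rep R G H) :
  D `<=` D' -> D_representation D pi -> D_representation D' pi.
Proof.
by move=> DD' [H0 [h0 hP hd hD]]; exists H0; split=> // x y hx hy; apply/DD'/hD.
Qed.

Lemma norm_D_mono D D' f : D `<=` D' -> (norm_D D f <= norm_D D' f)%E.
Proof.
move=> DD'; apply: norm_D_le => H pi Dpi x x1.
by apply: le_norm_D x1; exact: D_representation_sub Dpi.
Qed.

End NormD.

Section Decay.
Variables (R : realType) (d : nat).
Local Notation C := R[i].
Local Notation G := (free_group d).
Local Notation "x %:C" := (real_complex R x).

(** Two-sided translation changes the length of a word by a bounded amount, hence
    the weight by a bounded factor. *)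
Lemma ellp_decay_translate q (a : R) (phi : G -> C) s t : 0 < q -> 0 < a -> a < 1 ->
  ellp q%:E (fun r => (a ^+ wlen r)%:C * phi r) ->
  ellp q%:E (fun r => (a ^+ wlen (t^-1 * r * s)%g)%:C * phi r).
Proof.
move=> q0 a0 a1; have ap n : 0 <= a ^+ n by rewrite exprn_ge0 ?ltW.
apply: (@ellp_dominated _ _ _ ((a ^+ (wlen s + wlen t))^-1)) => [||r].
- exact: ltW.
- by rewrite invr_ge0.
rewrite !cnormM !cnorm_real !ger0_norm// mulrA ler_wpM2r ?cnorm_ge0//.
rewrite ler_pdivlMl ?exprn_gt0// -exprD ler_wiXn2l ?(ltW a0) ?(ltW a1)//.
rewrite -{1}(_ : t * (t^-1 * r * s) * s^-1 = r)%g; last first.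
  by rewrite !mulgA mulgV mul1g mulgK.
rewrite (leq_trans (wlenM _ _))// wlenV addnC -addnA leq_add2l.
exact: wlenM.
Qed.

Lemma expr_ge_linear (a : R) n : 0 <= a -> a <= 1 -> 1 - a ^+ n <= (1 - a) * n%:R.
Proof.
move=> a0 a1; elim: n => [|n IH]; first by rewrite expr0 subrr mulr0.
have an : a ^+ n <= 1 by rewrite exprn_ile1.
have h : (1 - a) * (1 - a ^+ n) >= 0 by rewrite mulr_ge0// subr_ge0.
by rewrite exprS -natr1 mulrDr mulr1; lra.
Qed.

(** Multiplication of the coefficients by [a ^+ wlen _] turns a
    [D]-representation into a [D']-representation, and as [a] tends to [1] the
    component at the neutral element of a deformed operator applied to a vacuum
    vector tends to the value of the original operator. *)
Theorem norm_D_le_of_decay (D D' : set (G -> C)) :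
  (forall a : R, 0 < a -> a < 1 -> exists q : R, [/\ 0 < q, ellp q%:E `<=` D' &
     forall phi, D phi -> ellp q%:E (fun r => (a ^+ wlen r)%:C * phi r)]) ->
  forall f, (norm_D D f <= norm_D D' f)%E.
Proof.
move=> HD f; apply: norm_D_le => H pi [H0 [h0 hP hd hD]] x x1.
have deformed a : 0 < a -> a < 1 ->
    ((rnorm (\sum_(s <- msupp f) mcoeff s f *: ((a ^+ wlen s)%:C *: pi s x)))%:E <= norm_D D' f)%E.
  move=> a0 a1; have a2 : a ^+ 2 < 1 by rewrite exprn_ilt1 ?(ltW a0).
  pose c := Num.sqrt (1 - a ^+ 2).
  have c0 : 0 < c by rewrite sqrtr_gt0 subr_gt0.
  have ac : a ^+ 2 + c ^+ 2 = 1 by rewrite sqr_sqrtr ?subr_ge0 ?(ltW a2)// addrC subrK.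
  have [q [q0 qD' Dq]] := HD a a0 a1.
  have tauD : D_representation D' (deform pi ac).
    apply: D_representation_sub qD' _; apply: (deform_D_representation ac h0 hP) => //.
    - by rewrite gt_eqF.
    - exact: ellp0.
    - by move=> u v; apply: ellpD; exact: ltW.
    - by move=> s t xi eta hxi heta; apply: ellp_decay_translate => //; exact/Dq/hD.
  have := @le_norm_D R G D' _ (deform pi ac) f (single 1%g x) tauD; rewrite rnorm_single => /(_ x1).
  apply: le_trans; rewrite lee_fin.
  have <- : l2val (rep_alg (deform pi ac) f (single 1%g x)) 1%g =
      \sum_(s <- msupp f) mcoeff s f *: ((a ^+ wlen s)%:C *: pi s x).
    rewrite /rep_alg.
    elim: (msupp f : seq G) => [|s r IH]; first by rewrite !big_nil.
    by rewrite !big_cons l2D IH l2Z deform_vacuum.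
  exact: rnorm_l2val.
rewrite leNgt; apply/negP => lt_x.
pose k := \sum_(s <- msupp f) cnorm (mcoeff s f) * (wlen s)%:R.
have k0 : 0 <= k by apply: sumr_ge0 => s _; rewrite mulr_ge0 ?cnorm_ge0.
have dist a : 0 < a -> a < 1 -> rnorm (rep_alg pi f x) <=
    rnorm (\sum_(s <- msupp f) mcoeff s f *: ((a ^+ wlen s)%:C *: pi s x)) + (1 - a) * k.
  move=> a0 a1; set z := (X in rnorm X + _).
  apply: le_trans (rnorm_le_dist _ z) _; rewrite lerD2l /z /rep_alg -sumrB.
  apply: le_trans (rnorm_sum _ _) _; rewrite /k mulr_sumr; apply: ler_sum => s _.
  rewrite -scalerBr rnormZ mulrCA ler_wpM2l ?cnorm_ge0//.
  rewrite -{1}[pi s x]scale1r -scalerBl rnormZ rep_norm -[1 - _]rmorphB cnorm_real.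
  have an : a ^+ wlen s <= 1 by rewrite exprn_ile1 ?ltW.
  rewrite ger0_norm ?subr_ge0//.
  apply: le_trans (expr_ge_linear (wlen s) (ltW a0) (ltW a1)).
  by rewrite ler_piMr// subr_ge0.
have half0 : 0 < 2^-1 :> R by rewrite invr_gt0.
have half1 : 2^-1 < 1 :> R by rewrite invf_lt1// ltr1n.
have Nfin : norm_D D' f \is a fin_num.
  rewrite fin_numE; apply/andP; split; apply/eqP => N.
    by have := deformed _ half0 half1; rewrite N leeNy_eq.
  by move: lt_x; rewrite N ltNge leey.
move: deformed lt_x; rewrite -(fineK Nfin); set N := fine _ => deformed.
rewrite lte_fin => Nx; set g := rnorm (rep_alg pi f x) - N.
have g0 : 0 < g by rewrite subr_gt0.
pose e := Num.min 2^-1 (g / 2 / (k + 1)).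
have k1 : 0 < k + 1 by rewrite ltr_wpDl.
have e0 : 0 < e by rewrite lt_min half0 !divr_gt0.
have e1 : e < 1 by rewrite gt_min half1.
have ek : e * k <= g / 2.
  apply: (@le_trans _ _ (e * (k + 1))); first by rewrite ler_wpM2l ?(ltW e0)// lerDl.
  by rewrite -ler_pdivlMr// ge_min lexx orbT.
have a0 : 0 < 1 - e by rewrite subr_gt0.
have a1 : 1 - e < 1 by rewrite gtrBl.
have := dist _ a0 a1; have := deformed _ a0 a1; rewrite lee_fin subKr /g in ek g0 *.
by lra.
Qed.

(** A function in all [ell_(p + e)] multiplied by one in [ell_r] with [r] finite
    lies in [ell_p], for the [e] with [1 / p = 1 / (p + e) + 1 / r]. *)
Lemma norm_D_ellp_Dplus (p : R) f : 2 <= p ->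
  norm_D (@ellp R G p%:E) f = norm_D (Dplus p) f.
Proof.
move=> p2; have p0 : 0 < p by rewrite (lt_le_trans _ p2).
apply/eqP; rewrite eq_le; apply/andP; split.
  apply: norm_D_mono => phi phip e e0; apply: ellp_le phip => //.
  by rewrite lerDl ltW.
apply: norm_D_le_of_decay => a a0 a1.
have [r rp ar] := ellp_wlen d (p + 1) a0 a1.
have r0 : 0 < r by rewrite (lt_le_trans _ rp)// addr_gt0.
have pr : 0 < r - p by rewrite subr_gt0 (lt_le_trans _ rp)// ltrDl.
exists p; split=> // phi Dphi.
(* the exponent solving [1 / p = 1 / r + 1 / (p + e)] *)
apply: (ellp_mul (q := r) (r := p + p ^+ 2 / (r - p))) => //.
- by rewrite addr_gt0// divr_gt0// exprn_gt0.
- field; rewrite !gt_eqF//.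
  by rewrite -[p * (r - p) + _](_ : p * r = _) ?mulr_gt0//; ring.
- by apply: Dphi; rewrite divr_gt0// exprn_gt0.
Qed.

Lemma Dminus_sub_ellp (p : \bar R) : (2%:E < p)%E -> @Dminus R G p `<=` ellp p.
Proof.
case: p => [p|_|//]; last first.
  move=> phi [q [q1 _ /ellpP phiq]]; have q0 : 0 < q by rewrite (lt_le_trans _ q1).
  exists (psum (fun s => cnorm (phi s) `^ q) `^ q^-1) => s.
  have pos t : 0 <= cnorm (phi t) `^ q by exact: powR_ge0.
  rewrite -[cnorm (phi s)](powRr1 (cnorm_ge0 _)) -(mulfV (lt0r_neq0 q0)) powRrM.
  apply: ge0_ler_powR; rewrite ?nnegrE ?invr_ge0 ?(ltW q0) ?psum_ge0//.
  exact: (psum_ge1 s pos phiq).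
move=> _ phi [q [q1]]; rewrite lte_fin => qp; apply: ellp_le; last exact: ltW.
exact: lt_le_trans q1.
Qed.

(** A function in [ell_p] multiplied by one in [ell_r] with [r] finite lies in
    [ell_q] with [1 / q = 1 / p + 1 / r], and [q < p]. *)
Lemma norm_D_ellp_Dminus (p : \bar R) f : (2%:E < p)%E ->
  norm_D (@ellp R G p) f = norm_D (Dminus p) f.
Proof.
move=> p2; apply/eqP; rewrite eq_le; apply/andP; split; last first.
  by apply: norm_D_mono; exact: Dminus_sub_ellp.
apply: norm_D_le_of_decay => a a0 a1.
(* [r] and [p] being at least [2], the exponent [q] is at least [1] *)
have [r r2 ar] := ellp_wlen d 2 a0 a1; have r0 : 0 < r by rewrite (lt_le_trans _ r2).
case: p p2 => [p|_|//]; last first.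
  exists r; split=> // [phi phir|phi [M HM]].
    by exists r; split=> //; rewrite ?ltry// (le_trans _ r2)// ler1n.
  have M0 : 0 <= M by rewrite (le_trans (cnorm_ge0 _) (HM 1%g)).
  apply: ellp_dominated ar; [exact: ltW|exact: M0|] => s.
  by rewrite cnormM mulrC ler_wpM2r ?cnorm_ge0.
rewrite lte_fin => p2; have p0 : 0 < p by rewrite (lt_trans _ p2).
have rp0 : 0 < r + p by rewrite addr_gt0.
exists (r * p / (r + p)); split.
- by rewrite divr_gt0// mulr_gt0.
- move=> phi phiq; exists (r * p / (r + p)); split=> //.
    by rewrite ler_pdivlMr// mul1r; nra.
  by rewrite lte_fin ltr_pdivrMr// mulrC ltr_pM2l// ltrDl.
- move=> phi phip; apply: (ellp_mul (p := r * p / (r + p)) r0 p0 _ _ ar phip).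
    by rewrite divr_gt0// mulr_gt0.
  by field; rewrite !gt_eqF.
Qed.

End Decay.

(** * The regular representation *)

(** Finite formal combinations of group elements, as lists of coefficient and
    element: products and adjoints of their operators are given by lists too,
    the same in every representation. *)
Section FormalCombinations.
Variables (R : realType) (G : groupType).
Local Notation C := R[i].
Implicit Types P Q : seq (C * G).

Definition lmul P Q : seq (C * G) :=
  [seq (p.1 * q.1, (p.2 * q.2)%g) | p <- P, q <- Q].
Definition ladj P : seq (C * G) := [seq (Num.conj p.1, p.2^-1%g) | p <- P].
Definition lpow P n : seq (C * G) := iter n (lmul P) [:: (1, 1%g)].

Section Operators.
Variables (H : hilbertSpace R) (pi : @unitary_rep R G H).
Implicit Types x y : H.

Definition lop P x : H := \sum_(p <- P) p.1 *: pi p.2 x.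

Lemma rep_algE f x : rep_alg pi f x = lop [seq (mcoeff s f, s) | s <- msupp f] x.
Proof. by rewrite /rep_alg /lop big_map. Qed.

Lemma lop_linear P : linear (lop P).
Proof.
move=> a x y; rewrite /lop scaler_sumr -big_split /=; apply: eq_bigr => p _.
by rewrite linearP scalerDr !scalerA mulrC.
Qed.
HB.instance Definition _ P := GRing.isLinear.Build C H H _ (lop P) (lop_linear P).

Lemma lop_mul P Q x : lop (lmul P Q) x = lop P (lop Q x).
Proof.
rewrite /lop big_allpairs_dep /=; apply: eq_bigr => p _.
rewrite linear_sum scaler_sumr; apply: eq_bigr => q _.
by rewrite repM linearZ scalerA.
Qed.

Lemma lop_adj P x y : hdot H (lop P x) y = hdot H x (lop (ladj P) y).
Proof.
rewrite /lop dot_suml dot_sumr big_map; apply: eq_bigr => p _.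
by rewrite dotZl dotZr conjCK rep_adj.
Qed.

Lemma lop_pow0 P x : lop (lpow P 0) x = x.
Proof. by rewrite /lop big_seq1 scale1r rep1. Qed.

Lemma lop_powS P n x : lop (lpow P n.+1) x = lop P (lop (lpow P n) x).
Proof. exact: lop_mul. Qed.

Lemma lop_powD P m n x : lop (lpow P (m + n)) x = lop (lpow P m) (lop (lpow P n) x).
Proof. by elim: m => [|m IH]; rewrite ?lop_pow0// addSn !lop_powS IH. Qed.

Lemma lop_bounded P x : rnorm (lop P x) <= (\sum_(p <- P) cnorm p.1) * rnorm x.
Proof.
apply: le_trans (rnorm_sum _ _) _; rewrite mulr_suml; apply: ler_sum => p _.
by rewrite rnormZ rep_norm.
Qed.

Lemma lop_dot P x y : hdot H (lop P x) y = \sum_(p <- P) p.1 * coef pi x y p.2.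
Proof. by rewrite /lop dot_suml; apply: eq_bigr => p _; rewrite dotZl. Qed.

Lemma lop_adj_bounded P (m : R) : 0 <= m ->
  (forall x, rnorm (lop P x) <= m * rnorm x) ->
  forall x, rnorm (lop (ladj P) x) <= m * rnorm x.
Proof.
move=> m0 Pm x; have x0 : 0 <= m * rnorm x by rewrite mulr_ge0 ?rnorm_ge0.
apply: (rnorm_le_dot x0) => y; rewrite dotC cnorm_conj -lop_adj.
rewrite (le_trans (cauchy_schwarz _ _))// mulrAC.
by rewrite ler_wpM2r ?rnorm_ge0// Pm.
Qed.

End Operators.
End FormalCombinations.

Section RegularRepresentation.
Variables (R : realType) (G : groupType).
Local Notation C := R[i].
Local Notation L := (l2 G (complex_hilbert R)).
Local Notation K := (l2_hilbert G (complex_hilbert R)).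

Lemma translate_psum (s : G) (u : G -> complex_hilbert R) : psummable (fun t => rnorm (u t) ^+ 2) ->
  psummable (fun t => rnorm (u (s^-1 * t)%g) ^+ 2) /\
  psum (fun t => rnorm (u (s^-1 * t)%g) ^+ 2) = psum (fun t => rnorm (u t) ^+ 2).
Proof.
have [e h] := psum_reindex (fun t => rnorm (u t) ^+ 2) (mulVKg s) (mulKg s).
by move=> su; split; [exact: h|exact: e].
Qed.

Definition translate (s : G) (u : L) : L :=
  @MkL2 R G (complex_hilbert R) (fun t => l2val u (s^-1 * t)%g)
    (introT (l2funP _) (translate_psum s (l2_summable u)).1).

Lemma translate_linear s : linear (translate s).
Proof. by move=> a u v; apply: l2_ext. Qed.
HB.instance Definition _ s := GRing.isLinear.Build C L L _ (translate s) (translate_linear s).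

Lemma translate_iso s u : rnorm (translate s u) = rnorm u.
Proof.
apply/eqP; rewrite -(eqrXn2 (n:=2))// ?rnorm_ge0// !l2_rnorm_sqr; apply/eqP.
exact: (translate_psum s (l2_summable u)).2.
Qed.

Definition regular : @unitary_rep R G K.
Proof.
refine (@UnitaryRep R G K (fun s => translate s) _ _ _).
- by move=> u; apply: l2_ext => t /=; rewrite invg1 mul1g.
- by move=> s t u; apply: l2_ext => r /=; rewrite invgM mulgA.
- by move=> s u v; apply: isometry_dot => w; exact: translate_iso.
Defined.

Lemma regular_single s t (z : complex_hilbert R) : regular s (single t z) = single (s * t)%g z.
Proof.
apply: l2_ext => r; rewrite [LHS]/=.
by rewrite -(inj_eq (mulgI s)) mulVKg.
Qed.

Lemma rep_alg_regular f (u : K) : l2val (rep_alg regular f u) = lambda f (l2val u).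
Proof.
apply/funext => t; rewrite /rep_alg /lambda.
elim: (msupp f : seq G) => [|s r IH]; first by rewrite !big_nil.
by rewrite !big_cons l2D IH.
Qed.

Lemma ell2_normE (u : K) : ell2_norm (l2val u : G -> C) = (rnorm u)%:E.
Proof.
rewrite /ell2_norm; under eq_esum do rewrite -rnorm_complex.
rewrite (psumE _ (l2_summable u)); last by move=> t; exact: rnorm_sqr_ge0.
rewrite -l2_rnorm_sqr poweR_EFin powR12_sqrt ?rnorm_sqr_ge0//.
by rewrite sqrtr_sqr ger0_norm ?rnorm_ge0.
Qed.

Lemma ell2_ball (xi : G -> C) : (ell2_norm xi <= 1)%E -> exists2 u : K, l2val u = xi & rnorm u <= 1.
Proof.
move=> xi1; have sxi : (xi : G -> complex_hilbert R) \in @l2fun R G (complex_hilbert R).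
  apply/l2funP; rewrite /psummable ltNge leye_eq; apply/eqP => xioo.
  move: xi1; rewrite /ell2_norm; under eq_esum do rewrite -rnorm_complex.
  by rewrite xioo poweRyr ?leye_eq// invr_eq0.
by exists (MkL2 sxi) => //; rewrite -lee_fin -ell2_normE.
Qed.

Lemma ellp_finite_support q (u : G -> C) (X : {fset G}) : 0 < q ->
  (forall s, s \notin X -> u s = 0) -> ellp q%:E u.
Proof.
move=> q0 uX; apply/ellpP.
have [s|s sX|//] := @psum_supp _ _ (fun s => cnorm (u s) `^ q) X.
  exact: powR_ge0.
by rewrite uX// cnorm0 powR0 ?gt_eqF.
Qed.

(** The finitely supported functions are dense, and their coefficients have
    finite support. *)
Lemma regular_D_representation (D : set (G -> C)) :
  (forall (u : G -> C) (X : {fset G}), (forall s, s \notin X -> u s = 0) -> D u) ->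
  D_representation D regular.
Proof.
move=> HD; pose S := [set u : K | exists X : {fset G}, forall t, t \notin X -> l2val u t = 0].
have S0 : S 0 by exists fset0.
have SP (a : C) u v : S u -> S v -> S (a *: u + v).
  move=> [X uX] [Y vY]; exists (X `|` Y)%fset => t.
  by rewrite inE negb_or => /andP[tX tY]; rewrite l2D l2Z uX// vY// scaler0 addr0.
exists S; split=> //.
- apply: (@dense_l2 _ _ _ setT) => // [|t x _].
    by apply/dense_rnorm => x e e0; exists x; rewrite ?subrr ?rnorm0.
  by exists [fset t]%fset => s; rewrite inE singleE => /negbTE ->.
- move=> u v [X uX] [Y vY].
  apply: (HD _ [fset (y * x^-1)%g | y in Y, x in X]%fset) => s sXY.
  have zero t : hdot (complex_hilbert R) (l2val u (s^-1 * t)%g) (l2val v t) = 0.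
    have [tY|tY] := boolP (t \in Y); last by rewrite vY// dot0r.
    rewrite uX ?dot0l//; apply: contraNN sXY => sX; apply/imfset2P.
    by exists t => //; exists (s^-1 * t)%g => //; rewrite invgM invgK mulVKg.
  rewrite /coef [LHS]/= /l2dot (@csum1 _ _ _ 1%g) => [|t _]; exact: zero.
Qed.

Lemma norm_reduced_le f : (norm_reduced f <= norm_D (@Dplus R G 2) f)%E.
Proof.
apply: ge_ereal_sup => _ [xi /ell2_ball[u <- u1] <-].
rewrite -rep_alg_regular ell2_normE; apply: le_norm_D u1.
apply: regular_D_representation => v X vX e e0.
by apply: ellp_finite_support vX; rewrite addr_gt0.
Qed.

Lemma norm_reduced_bound f (m : R) : norm_reduced f = m%:E ->
  0 <= m /\ forall u : K, rnorm (rep_alg regular f u) <= m * rnorm u.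
Proof.
move=> fm; have bound (u : K) : rnorm u <= 1 -> rnorm (rep_alg regular f u) <= m.
  move=> u1; rewrite -lee_fin -fm -ell2_normE rep_alg_regular.
  by apply: ereal_sup_ubound; exists (l2val u) => //=; rewrite ell2_normE.
have m0 : 0 <= m by apply: le_trans (bound 0 _); rewrite ?rnorm_ge0 ?rnorm0.
split=> // u; have [u0|u0] := eqVneq (rnorm u) 0.
  by rewrite u0 mulr0 (rnorm0_eq0 u0) rep_algE linear0 rnorm0.
have u1 : 0 < rnorm u by rewrite lt_neqAle eq_sym u0 rnorm_ge0.
pose k : C := ((rnorm u)^-1%:C)%C.
have kn : cnorm k = (rnorm u)^-1 by rewrite cnorm_real ger0_norm ?invr_ge0 ?ltW.
have := bound (k *: u); rewrite rnormZ kn mulVf// => /(_ (lexx _)).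
by rewrite !rep_algE linearZ rnormZ kn ler_pdivrMl// [_ * m]mulrC.
Qed.

End RegularRepresentation.

Section WeakContainment.
Variables (R : realType).
Local Notation C := R[i].

(** The ratios of a log-convex sequence increase, so it grows at least as fast as
    the geometric sequence with its first ratio; an upper bound on the growth
    therefore bounds that ratio. *)
Lemma log_convex_ratio (c : nat -> R) (b k : R) : 0 <= b -> (forall n, 0 <= c n) ->
  (forall n, c n.+1 ^+ 2 <= c n * c n.+2) ->
  (forall n, c n ^+ 2 <= k * (b ^+ 2) ^+ n) -> c 1%N <= b * c 0%N.
Proof.
move=> b0 c0 cc ck; rewrite leNgt; apply/negP => lt_c.
have c00 : 0 < c 0%N.
  rewrite lt_neqAle c0 andbT eq_sym; apply: contraTneq lt_c => c00.
  rewrite -leNgt c00 mulr0; have := cc 0%N; rewrite c00 mul0r.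
  by have := c0 1%N; nra.
pose r := c 1%N / c 0%N; have br : b < r by rewrite ltr_pdivlMr.
have r0 : 0 < r by exact: le_lt_trans br.
have grow n : 0 < c n /\ r * c n <= c n.+1.
  elim: n => [|n [cn rcn]]; first by rewrite /r divfK ?gt_eqF.
  have cn1 : 0 < c n.+1 by apply: lt_le_trans rcn; rewrite mulr_gt0.
  split=> //; rewrite -(ler_pM2l cn); apply: le_trans (cc n).
  by rewrite mulrCA mulrA expr2 ler_wpM2r ?(ltW cn1).
have growth n : r ^+ n * c 0%N <= c n.
  elim: n => [|n IH]; first by rewrite expr0 mul1r.
  by rewrite exprS -mulrA (le_trans _ (grow n).2)// ler_wpM2l// ltW.
pose z := b ^+ 2 / r ^+ 2.
have z0 : 0 <= z by rewrite divr_ge0 ?exprn_ge0// ltW.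
have z1 : z < 1 by rewrite ltr_pdivrMr ?exprn_gt0// mul1r ltr_sqr ?nnegrE// ltW.
have small n : c 0%N ^+ 2 <= k * z ^+ n.
  rewrite /z expr_div_n mulrA ler_pdivlMr ?exprn_gt0// -exprM mulnC exprM -exprMn.
  apply: le_trans (ck n); rewrite mulrC ler_sqr ?nnegrE ?mulr_ge0 ?exprn_ge0 ?(ltW r0)//.
have k0 : 0 <= k by have := ck 0%N; rewrite expr0 mulr1; apply: le_trans; rewrite exprn_ge0.
pose e := c 0%N ^+ 2 / (k + 1).
have k1 : 0 < k + 1 by rewrite ltr_wpDl.
have e0 : 0 < e by rewrite divr_gt0// exprn_gt0.
have : z ^+ n @[n --> \oo] --> 0 by apply: cvg_expr; rewrite ger0_norm.
move=> /cvgrPdist_lt /(_ _ e0)[n _ /(_ n (leqnn _))].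
rewrite /= sub0r normrN ger0_norm ?exprn_ge0// /e ltr_pdivlMr// => zn.
have := small n; have := exprn_ge0 n z0; lra.
Qed.

Variables (G : groupType).

(** Powers of the positive operator [pi(f)^* pi(f)] have coefficients
    controlled by the regular representation, since a coefficient of [pi] at
    [xi] is square-summable. The norms of the vectors obtained by applying these
    powers to [xi] are log-convex, so the bound on their growth is a bound on
    the first ratio. *)
Lemma ell2_coef_bound (H : hilbertSpace R) (pi : @unitary_rep R G H) f (m : R) xi :
  norm_reduced f = m%:E -> ellp 2%:E (coef pi xi xi) ->
  rnorm (rep_alg pi f xi) <= m * rnorm xi.
Proof.
move=> /norm_reduced_bound[m0 Lm] /ellpP phi2.
pose P := [seq (mcoeff s f, s) | s <- msupp f].
pose Q := lmul (ladj P) P.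
pose K := l2_hilbert G (complex_hilbert R).
have LQ n (u : K) : rnorm (lop (regular R G) (lpow Q n) u) <= (m ^+ 2) ^+ n * rnorm u.
  elim: n => [|n IH]; first by rewrite lop_pow0 expr0 mul1r.
  rewrite lop_powS lop_mul.
  have Lm' (v : K) : rnorm (lop (regular R G) P v) <= m * rnorm v by rewrite -rep_algE.
  apply: le_trans (lop_adj_bounded m0 Lm' _) _.
  rewrite exprS [m ^+ 2]expr2 -!mulrA; apply: ler_wpM2l => //.
  by apply: le_trans (Lm' _) _; rewrite ler_wpM2l.
have Qadj x y : hdot H (lop pi Q x) y = hdot H x (lop pi Q y).
  by rewrite !lop_mul -lop_adj [LHS]dotC -lop_adj -dotC.
have Qpow_adj n x y : hdot H (lop pi (lpow Q n) x) y = hdot H x (lop pi (lpow Q n) y).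
  elim: n x y => [|n IH] x y; first by rewrite !lop_pow0.
  by rewrite lop_powS Qadj IH -addn1 lop_powD lop_powS lop_pow0.
pose c n := rnorm (lop pi (lpow Q n) xi).
have c0 n : 0 <= c n by exact: rnorm_ge0.
have cE n : c n ^+ 2 = cnorm (hdot H (lop pi (lpow Q (n + n)) xi) xi).
  rewrite lop_powD Qpow_adj hdotE rnormE -rmorphXn cnorm_real ger0_norm//.
  exact: rnorm_sqr_ge0.
have psi_l2 : (fun t => Num.conj (coef pi xi xi t)) \in @l2fun R G (complex_hilbert R).
  apply/l2funP; rewrite (_ : (fun t => _) = fun s => cnorm (coef pi xi xi s) `^ 2)//.
  by apply/funext => t; rewrite rnorm_complex cnorm_conj powR_mulrn ?cnorm_ge0.
pose psi : K := MkL2 psi_l2; pose delta : K := single 1%g ((1 : cline R) : complex_hilbert R).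
have ck n : c n ^+ 2 <= rnorm delta * rnorm psi * ((m ^+ 2) ^+ 2) ^+ n.
  have -> : c n ^+ 2 = cnorm (hdot K (lop (regular R G) (lpow Q (n + n)) delta) psi).
    rewrite cE !lop_dot; congr cnorm; apply: eq_bigr => p _; congr (_ * _).
    rewrite [RHS]/coef regular_single mulg1 dot_single.
    by rewrite [RHS]/= /cdot conjCK mul1r.
  apply: le_trans (cauchy_schwarz _ _) _; rewrite mulrAC ler_wpM2r ?rnorm_ge0//.
  by apply: le_trans (LQ _ _) _; rewrite mulrC addnn -mul2n exprM.
have cc n : c n.+1 ^+ 2 <= c n * c n.+2.
  by rewrite cE addSnnS lop_powD Qpow_adj (le_trans (cauchy_schwarz _ _))// mulrC.
have ratio : c 1%N <= m ^+ 2 * c 0%N := log_convex_ratio (exprn_ge0 2 m0) c0 cc ck.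
have c0E : c 0%N = rnorm xi by rewrite /c lop_pow0.
have c1E : c 1%N = rnorm (lop pi Q xi) by rewrite /c lop_powS lop_pow0.
rewrite -ler_sqr ?nnegrE ?mulr_ge0 ?rnorm_ge0// rep_algE -sqn_hdot /sqn.
rewrite lop_adj -lop_mul (le_trans (Re_le_cnorm _))// (le_trans (cauchy_schwarz _ _))//.
by rewrite -/P -/Q -c1E -c0E; have := c0 0%N; nra.
Qed.

(** The bound on the dense subspace extends to all vectors because the operators
    of the group ring are bounded. *)
Lemma norm_D_ell2_le f : (norm_D (@ellp R G 2%:E) f <= norm_reduced f)%E.
Proof.
have [->|Nfin] := eqVneq (norm_reduced f) +oo%E; first exact: leey.
have {}Nfin : norm_reduced f \is a fin_num.
  rewrite fin_numE Nfin andbT -ltNye; apply: (@lt_le_trans _ _ 0%E) => //.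
  apply: (@le_trans _ _ (ell2_norm (lambda f (fun=> 0)))).
    by rewrite /ell2_norm poweR_ge0.
  apply: ereal_sup_ubound; exists (fun=> 0) => //=.
  by rewrite (ell2_normE (0 : l2_hilbert G (complex_hilbert R))) rnorm0 lee_fin.
set m := fine (norm_reduced f); have fm : norm_reduced f = m%:E by rewrite fineK.
have [m0 _] := norm_reduced_bound fm.
apply: norm_D_le => H pi [H0 [h0 hP hd hD]] x x1; rewrite fm lee_fin.
pose P := [seq (mcoeff s f, s) | s <- msupp f].
pose B := \sum_(p <- P) cnorm p.1 + m + 1.
have sB : 0 <= \sum_(p <- P) cnorm p.1 by apply: sumr_ge0 => p _; exact: cnorm_ge0.
have B0 : 0 < B by rewrite ltr_wpDl// addr_ge0.
apply/ler_addgt0Pr => e e0.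
have /dense_rnorm/(_ x _ (divr_gt0 e0 B0))[y Hy xy] := hd.
have ymx : rnorm y <= 1 + rnorm (x - y).
  by rewrite rnormBC (le_trans (rnorm_le_dist y x))// lerD2r.
have yb := ell2_coef_bound fm (hD y y Hy Hy).
apply: le_trans (rnorm_le_dist _ (rep_alg pi f y)) _.
have -> : rep_alg pi f x - rep_alg pi f y = lop pi P (x - y) by rewrite !rep_algE linearB.
have bxy := lop_bounded pi P (x - y).
have Bxy : B * rnorm (x - y) <= e by rewrite mulrC -ler_pdivlMr// ltW.
have d0 := rnorm_ge0 (x - y).
have my : m * rnorm y <= m * (1 + rnorm (x - y)) by rewrite ler_wpM2l.
rewrite /B in Bxy; lra.
Qed.

Lemma norm_full_ellp f : norm_full f = norm_D (@ellp R G +oo%E) f.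
Proof.
apply/eqP; rewrite eq_le; apply/andP; split; apply: le_ereal_sup => c0 [H [pi]]; last first.
  by move=> [_ ->]; exists H, pi.
move=> ->; exists H, pi; split=> //; exists setT; split=> //.
  by apply/dense_rnorm => x e e0; exists x; rewrite ?subrr ?rnorm0.
move=> x y _ _; exists (rnorm x * rnorm y) => s.
by rewrite (le_trans (cauchy_schwarz _ _))// rep_norm.
Qed.

End WeakContainment.

(** * Isomorphism of completions *)

(** Two normed spaces with isometric dense images of the same vector space: the
    elements approximated by the images of the same vectors correspond. *)
Section CompletionMatch.
Variables (R : realType) (V : lmodType R[i]) (A B : completeNormedModType R[i]).
Variables (eA : {linear V -> A}) (eB : {linear V -> B}).
Hypothesis eAB : forall v, rnorm (eA v) = rnorm (eB v).
Local Notation C := R[i].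

Definition matched (a : A) (b : B) := forall e : R, 0 < e ->
  exists v, rnorm (eA v - a) < e /\ rnorm (eB v - b) < e.

Lemma matched_emb v : matched (eA v) (eB v).
Proof. by move=> e e0; exists v; rewrite !subrr !rnorm0. Qed.

Lemma matched_ex a : dense (range eA) -> exists b, matched a b.
Proof.
move=> /dense_rnorm dA.
have n0 (n : nat) : 0 < (n.+1%:R : R)^-1 by rewrite invr_gt0.
have /choice[v va] (n : nat) : exists v, rnorm (eA v - a) < (n.+1%:R)^-1.
  by have [_ [v _ <-] av] := dA a _ (n0 n); exists v; rewrite rnormBC.
have small (e : R) : 0 < e -> exists N, forall n, (N <= n)%N -> rnorm (eA (v n) - a) < e.
  move=> e0; have [N _ HN] := near_infty_natSinv_lt (PosNum e0).
  by exists N => n Nn; rewrite (lt_trans (va n))//; exact: HN.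
have [|b vb] := @seq_complete _ _ (fun n => eB (v n)).
  move=> e e0; have [N HN] := small _ (divr_gt0 e0 (ltr0n R 2)).
  exists N => m n Nm Nn; rewrite -linearB -eAB linearB.
  rewrite (le_lt_trans (rnormB_trans _ a _))// [e]splitr ltrD ?HN//.
  by rewrite rnormBC HN.
exists b => e e0; have [N HN] := small _ e0; have [M HM] := vb _ e0.
by exists (v (maxn N M)); rewrite HN ?HM// ?leq_maxl ?leq_maxr.
Qed.

Lemma matched_uniq a b b' : matched a b -> matched a b' -> b = b'.
Proof.
move=> ab ab'; apply/eqP; rewrite -subr_eq0; apply/eqP/rnorm0_eq0.
apply/eqP; rewrite eq_le rnorm_ge0 andbT; apply/ler_addgt0Pr => e e0; rewrite add0r.
have e4 : 0 < e / 4 by rewrite divr_gt0.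
have [v [va vb]] := ab _ e4; have [w [wa wb]] := ab' _ e4.
have vw : rnorm (eB v - eB w) <= rnorm (eA v - a) + rnorm (eA w - a).
  by rewrite -linearB -eAB linearB (rnormBC (eA w)) rnormB_trans.
have h1 := rnormB_trans b (eB v) b'; have h2 := rnormB_trans (eB v) (eB w) b'.
rewrite (rnormBC b (eB v)) in h1; lra.
Qed.

Lemma matched_linear (k : C) a b a' b' : matched a b -> matched a' b' ->
  matched (k *: a + a') (k *: b + b').
Proof.
move=> ab ab' e e0; pose K := cnorm k + 1.
have K0 : 0 < K by rewrite ltr_wpDl ?cnorm_ge0.
have [v [va vb]] := ab _ (divr_gt0 (divr_gt0 e0 (ltr0n R 2)) K0).
have [w [wa wb]] := ab' _ (divr_gt0 e0 (ltr0n R 2)).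
have aux (W : normedModType C) (x y x' y' : W) : rnorm (x - y) < e / 2 / K ->
    rnorm (x' - y') < e / 2 -> rnorm (k *: x + x' - (k *: y + y')) < e.
  move=> xy xy'; rewrite opprD addrACA -scalerBr (le_lt_trans (rnormD _ _))//.
  rewrite [e]splitr ler_ltD// rnormZ; apply: le_trans (_ : K * rnorm (x - y) <= _).
    by rewrite ler_wpM2r ?rnorm_ge0// lerDl.
  by rewrite mulrC -ler_pdivlMr// ltW.
exists (k *: v + w); rewrite (linearP eA) (linearP eB); split.
  exact: (aux A _ _ _ _ va wa).
exact: (aux B _ _ _ _ vb wb).
Qed.

End CompletionMatch.

Lemma matched_sym (R : realType) (V : lmodType R[i]) (A B : completeNormedModType R[i])
  (eA : {linear V -> A}) (eB : {linear V -> B}) a b :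
  matched eA eB a b -> matched eB eA b a.
Proof. by move=> ab e /ab[v [va vb]]; exists v. Qed.

(** The product and the adjoint of a C*-algebra are continuous, the latter being
    isometric by the C*-identity. *)
Section CstarNorm.
Variables (R : realType) (A : cstarAlgebra R).
Implicit Types x y : A.

Lemma rnorm_cmul x y : rnorm (cmul x y) <= rnorm x * rnorm y.
Proof. by have := cmul_norm x y; rewrite !rnormE -rmorphM lecR. Qed.

Lemma rnorm_cstar_le x : rnorm x <= rnorm (cstar x).
Proof.
have [x0|x0] := eqVneq (rnorm x) 0; first by rewrite x0 rnorm_ge0.
have xx : rnorm x ^+ 2 = rnorm (cmul (cstar x) x).
  by apply: (@complexI R); rewrite rmorphXn /= -!rnormE cstar_norm.
have := rnorm_cmul (cstar x) x; rewrite -xx expr2 ler_pM2r//.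
by rewrite lt_neqAle eq_sym x0 rnorm_ge0.
Qed.

Lemma rnorm_cstar x : rnorm (cstar x) = rnorm x.
Proof.
apply/eqP; rewrite eq_le rnorm_cstar_le andbT.
by have := rnorm_cstar_le (cstar x); rewrite cstarK.
Qed.

Lemma cstarB x y : cstar (x - y) = cstar x - cstar y.
Proof.
have := cstar_antilinear (-1) y x.
by rewrite !scaleN1r addrC rmorphN rmorph1 scaleN1r [in RHS]addrC.
Qed.

Lemma rnorm_cmulB x y x' y' :
  rnorm (cmul x y - cmul x' y') <=
  rnorm (x - x') * (rnorm y' + rnorm (y - y')) + rnorm x' * rnorm (y - y').
Proof.
apply: le_trans (rnormB_trans _ (cmul x' y) _) _.
rewrite -linearBl -linearBr lerD//; apply: le_trans (rnorm_cmul _ _) _ => //.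
by rewrite ler_wpM2l ?rnorm_ge0 ?rnorm_le_dist.
Qed.

End CstarNorm.

Section Completions.
Variables (R : realType) (G : groupType).
Local Notation C := R[i].
Local Notation CG := (malg G C).
Variables (N1 N2 : CG -> \bar R).

Section Match.
Variables (A : cstar_completion N1) (B : cstar_completion N2).

Lemma matched_mul a b a' b' : matched (emb A) (emb B) a b -> matched (emb A) (emb B) a' b' ->
  matched (emb A) (emb B) (cmul a a') (cmul b b').
Proof.
move=> ab ab' e e0; pose K := rnorm a + rnorm a' + rnorm b + rnorm b' + 1.
have K0 : 0 < K by rewrite ltr_wpDl ?addr_ge0 ?rnorm_ge0.
pose dl := Num.min 1 (e / K).
have dl0 : 0 < dl by rewrite lt_min ltr01 divr_gt0.
have dl1 : dl <= 1 by rewrite ge_min lexx.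
have dlK : dl * K <= e by rewrite -ler_pdivlMr// ge_min lexx orbT.
have aux (W : cstarAlgebra R) (x y x' y' : W) : rnorm (x - x') < dl -> rnorm (y - y') < dl ->
    rnorm y' + rnorm x' + 1 <= K -> rnorm (cmul x y - cmul x' y') < e.
  move=> xx yy yxK; apply: le_lt_trans (rnorm_cmulB _ _ _ _) _.
  have := rnorm_ge0 (x - x'); have := rnorm_ge0 (y - y').
  have := rnorm_ge0 x'; have := rnorm_ge0 y'.
  nra.
have [f [fa fb]] := ab _ dl0; have [g [ga gb]] := ab' _ dl0.
exists (Defs.conv f g); rewrite !embM; split; apply: aux => //; rewrite /K.
  by have := rnorm_ge0 b; have := rnorm_ge0 b'; lra.
by have := rnorm_ge0 a; have := rnorm_ge0 a'; lra.
Qed.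

Lemma matched_star a b : matched (emb A) (emb B) a b ->
  matched (emb A) (emb B) (cstar a) (cstar b).
Proof.
move=> ab e /ab[f [fa fb]]; exists (conv_star f).
by rewrite !emb_star -!cstarB !rnorm_cstar.
Qed.

Lemma matched_one : matched (emb A) (emb B) cone cone.
Proof. by rewrite -(emb1 A) -(emb1 B); exact: matched_emb. Qed.

End Match.

(** Matching is a relation compatible with all operations, total and
    single-valued in both directions, hence the graph of an isomorphism. *)
Lemma canonically_isomorphic_of_eq :
  (forall f, N1 f = N2 f) -> canonically_isomorphic N1 N2.
Proof.
move=> N12; split=> // A B.
have eAB f : rnorm (emb A f) = rnorm (emb B f) by apply: EFin_inj; rewrite !emb_norm.
have eBA f : rnorm (emb B f) = rnorm (emb A f) by rewrite eAB.
have /choice[phi phiP] a := matched_ex eAB a (@emb_dense _ _ _ A).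
have /choice[psi psiP] b := matched_ex eBA b (@emb_dense _ _ _ B).
have phi_uniq a b : matched (emb A) (emb B) a b -> phi a = b.
  exact: (matched_uniq eAB (phiP a)).
have phi_linear : linear phi.
  by move=> k a a'; apply: phi_uniq; exact: matched_linear.
pose lphi := GRing.isLinear.Build C A B _ phi phi_linear.
pose Phi : {linear A -> B} := HB.pack phi lphi.
exists Phi; split; last by move=> f; apply: phi_uniq; exact: matched_emb.
split.
- exists psi => x.
    by apply: (matched_uniq eBA (psiP _)); exact/matched_sym/phiP.
  by apply: phi_uniq; exact/matched_sym/psiP.
- by apply: phi_uniq; exact: matched_one.
- by move=> x y; apply: phi_uniq; exact: matched_mul (phiP x) (phiP y).
- by move=> x; apply: phi_uniq; exact: matched_star (phiP x).
Qed.

End Completions.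

Theorem corollary3p10 (R : realType) (d : nat) (hd : (2 <= d)%N) :
  ((forall p : R, 2 <= p ->
      canonically_isomorphic (G := free_group d)
        (norm_D (ellp p%:E)) (norm_D (Dplus p)))
   /\ canonically_isomorphic (R := R) (G := free_group d)
        norm_reduced (norm_D (Dplus 2)))
  /\
  ((forall p : \bar R, (2%:E < p)%E ->
      canonically_isomorphic (G := free_group d)
        (norm_D (ellp p)) (norm_D (Dminus p)))
   /\ canonically_isomorphic (R := R) (G := free_group d)
        norm_full (norm_D (Dminus +oo%E))).
Proof.
split; split=> [p p2|]; apply: canonically_isomorphic_of_eq => f.
- exact: norm_D_ellp_Dplus.
- apply/eqP; rewrite eq_le norm_reduced_le /= -norm_D_ellp_Dplus//.
  exact: norm_D_ell2_le.
- exact: norm_D_ellp_Dminus.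
- by rewrite norm_full_ellp norm_D_ellp_Dminus// ltry.
Qed.
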